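(* Let $p$ be a prime number or zero, and let $\kappa,\lambda$ be (possibly finite) cardinals. Then there is, up to isomorphism of $L$-structures, a unique model $(F,K;\chi)$ of $\mathrm{ACFC}_p$ such that $\mathrm{trdeg}(F\mid\mathbb{F}_p)=\kappa$ and $\mathrm{trdeg}\big(K\mid\mathbb{Q}(\chi(F))\big)=\lambda$.
   Context: A character $\chi:F\to K$ between integral domains is a map with $\chi(ab)=\chi(a)\chi(b)$ for all $a,b\in F$, $\chi(0)=0$ and $\chi(1)=1$. A structure $(F,K;\chi)$ of this kind is a structure in the $2$-sorted language $L$, which consists of two disjoint copies of the language of rings (one for each sort) augmented by a unary function symbol $\chi$ from the first sort to the second. For $n\ge 1$, $\alpha\in F^n$ and $k\in\mathbb{N}^n$ put $\alpha^k=\alpha_1^{k_1}\cdots\alpha_n^{k_n}$. The tuple $\alpha$ is multiplicatively dependent if $\alpha^k=\alpha^l$ for some distinct $k,l\in\mathbb{N}^n$, and multiplicatively independent otherwise. A character $\chi:F\to K$ is generic if it is injective and, for every $n\ge1$ and every multiplicatively independent $\alpha\in F^n$, the tuple $\chi(\alpha)=(\chi(\alpha_1),\dots,\chi(\alpha_n))$ is algebraically independent, in the fraction field of $K$, over its prime field. $\mathrm{ACFC}$ is a recursive set of $\forall\exists$-sentences of $L$ whose models are exactly the structures $(F,K;\chi)$ with $F,K$ algebraically closed fields, $\mathrm{char}(K)=0$ and $\chi$ a generic character. For $p$ prime or zero, $\mathrm{ACFC}_p$ is $\mathrm{ACFC}$ together with sentences expressing $\mathrm{char}(F)=p$. For $p=0$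 we set $\mathbb{F}_p:=\mathbb{Q}$. *)

(* Defs.v *)
From mathcomp Require Import all_boot all_algebra.
From mathcomp Require Import classical_sets cardinality.
From mathcomp Require Import mpoly.

Set Implicit Arguments.
Unset Strict Implicit.
Unset Printing Implicit Defensive.

Import GRing.Theory.

Local Open Scope classical_set_scope.
Local Open Scope ring_scope.

Section FieldTheory.

Variable L : fieldType.
Implicit Types (A B k : set L).

(* The smallest subfield of L containing A. *)
Definition generated_subfield A : set L :=
  [set x | forall S : {pred L},
     GRing.divring_closed S -> (forall a, A a -> a \in S) -> x \in S].

Definition prime_subfield : set L := generated_subfield set0.

(* Polynomials over k are encoded as polynomials over L all of whose
   coefficients lie in k. *)
Definition algebraic_over k (x : L) : Prop :=
  exists P : {poly L}, [/\ P != 0, forall i, k P`_i & root P x].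

Definition alg_independent k (n : nat) (a : 'I_n -> L) : Prop :=
  forall P : {mpoly L[n]}, (forall m, k P@_m) -> P.@[a] = 0 -> P = 0.

Definition transcendence_basis k B : Prop :=
  (forall (n : nat) (a : 'I_n -> L),
     injective a -> (forall i, B (a i)) -> alg_independent k a) /\
  (forall x : L, algebraic_over (generated_subfield (k `|` B)) x).

(* trdeg(L | k) = kappa, the cardinal kappa being represented by an arbitrary
   (finite, possibly empty, or infinite) type of that cardinality. *)
Definition trdeg_eq k (kappa : Type) : Prop :=
  exists B : set L, transcendence_basis k B /\ (B #= [set: kappa])%card.

End FieldTheory.

Arguments prime_subfield L : clear implicits.

Definition has_char (L : fieldType) (p : nat) : Prop :=
  if p is 0%N then [pchar L] =i pred0 else p \in [pchar L].

Definition mult_dependent (F : idomainType) (n : nat) (a : 'I_n -> F) : Prop :=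
  exists k l : {ffun 'I_n -> nat},
    k != l /\ \prod_(i < n) a i ^+ k i = \prod_(i < n) a i ^+ l i.

Section Character.

Variables (F K : idomainType) (chi : F -> K).

Definition is_character : Prop :=
  [/\ {morph chi : a b / a * b >-> a * b}, chi 0 = 0 & chi 1 = 1].

Definition generic : Prop :=
  injective chi /\
  forall (n : nat) (a : 'I_n -> F), (1 <= n)%N -> ~ mult_dependent a ->
    alg_independent (prime_subfield {fraction K})
      (fun i => tofrac (chi (a i))).

End Character.

Record ACFC_model (p : nat) := {
  dom : closedFieldType;
  cod : closedFieldType;
  chi : dom -> cod;
  chi_character : is_character chi;
  chi_generic : generic chi;
  cod_char0 : has_char cod 0;
  dom_char : has_char dom p
}.

Definition L_isomorphic (p : nat) (M N : ACFC_model p) : Prop :=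
  exists (f : {rmorphism dom M -> dom N}) (g : {rmorphism cod M -> cod N}),
    [/\ bijective f, bijective g & forall x, g (chi x) = chi (f x)].

(* trdeg(F | F_p) = kappa and trdeg(K | Q(chi(F))) = lambda; the prime subfield
   of F is F_p for p prime and Q for p = 0, and, K having characteristic 0,
   Q(chi(F)) is the subfield generated by chi(F). *)
Definition has_trdegs (p : nat) (M : ACFC_model p) (kappa lambda : Type) : Prop :=
  trdeg_eq (prime_subfield (dom M)) kappa /\
  trdeg_eq (generated_subfield (range (@chi p M))) lambda.

(* Main.v *)
Require Import Defs.
From HB Require Import structures.
From mathcomp Require Import all_boot all_algebra all_field.
From mathcomp Require Import cyclic ring_quotient generic_quotient.
From mathcomp Require Import boolp classical_sets functions cardinality filter.
From mathcomp Require Import mpoly ring.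

Set Implicit Arguments.
Unset Strict Implicit.
Unset Printing Implicit Defensive.
Import GRing.Theory.
Local Open Scope classical_set_scope.
Local Open Scope ring_scope.

(** Existence.  Both fields are cut out of a large algebraically closed field.
    If k is algebraically closed, an ultrapower of k indexed by the points of
    the affine space k^I is algebraically closed, and when the ultrafilter
    contains the nonvanishing sets of all nonzero polynomial functions, the
    classes of the coordinate functions are algebraically independent
    ([big_field]).  The relative algebraic closure of these coordinates, with
    I = kappa, is the field F.  For K, take a field O of characteristic 0 with
    independent elements x_a (a in F) and y_l (l in lambda).  By Zorn's lemma a
    maximal injective partial homomorphism from the units of F to the units of
    O, which sends new elements independent modulo torsion to the corresponding
    x_a, is everywhere defined ([exists_generic]): a root of order l of an
    element of the domain H can always be added, since the image already has l
    roots of order l in characteristic 0, and these cannot all be images of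
    roots in H as long as a root is missing in H.  Then K is the relative
    closure of the x_a that were used together with the y_l.

    Uniqueness.  Steinitz's theorem ([steinitz]) extends an isomorphism between
    subrings to algebraically closed fields along a bijection of transcendence
    bases.  With the prime rings as subrings, it shows that F is determined by
    p and kappa.  Once the two copies of F are identified, applying it again to
    the rings of integer combinations of the values of the two characters gives
    the isomorphism of the second sorts, provided that these characters satisfy
    the same linear relations with integer coefficients ([character_relation]).
    This holds because a relation can be split along the classes of F^* modulo
    torsion: values of a generic character at elements that are distinct modulo
    torsion are linearly independent over the algebraic numbers
    ([linear_independence]), for these values are, up to roots of unity,
    distinct Laurent monomials in algebraically independent elements.  Within
    one class only a relation between roots of unity remains, and that one is
    decided by the irreducibility of the cyclotomic polynomials
    ([prim_root_conjugate]).

    All arguments on transcendence use the closure operator [acl]: a family is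
    algebraically independent if and only if none of its members lies in the
    closure of the others ([alg_independentP]).  *)

Local Notation gen := generated_subfield.

(** * Subfields and relative algebraic closure *)

Section Subfields.
Variable L : fieldType.
Implicit Types (A B S : set L) (x y : L).

Definition subfield_set S :=
  [/\ S 1, forall x y, S x -> S y -> S (x - y)
         & forall x y, S x -> S y -> S (x / y)].

Definition subring_set S :=
  [/\ S 1, forall x y, S x -> S y -> S (x - y)
         & forall x y, S x -> S y -> S (x * y)].

(** The model-theoretic algebraic closure of a set of parameters in a field.  Its
    calculus (monotone, idempotent, compatible with embeddings) replaces
    computations with polynomials in most of what follows.  *)
Definition acl A : set L := algebraic_over (gen A).

Lemma gen_subfield A : subfield_set (gen A).
Proof.
split=> [S hS _|x y Ax Ay S hS hA|x y Ax Ay S hS hA].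
- by case: hS.
- by case: (hS) => _ hB _; apply: hB; [apply: Ax|apply: Ay].
- by case: (hS) => _ _ hB; apply: hB; [apply: Ax|apply: Ay].
Qed.

Lemma gen_min A S : subfield_set S -> A `<=` S -> gen A `<=` S.
Proof.
move=> [S1 SB SV] AS x Ax; apply/set_mem/(Ax [pred y | y \in S]).
  by split=> [|u v|u v]; rewrite ?inE; [|apply: SB|apply: SV].
by move=> a /AS /mem_set.
Qed.

Lemma sub_gen A : A `<=` gen A.
Proof. by move=> x Ax S _; apply. Qed.

Lemma gen_mono A B : A `<=` B -> gen A `<=` gen B.
Proof. by move=> AB; apply: gen_min (gen_subfield B) (subset_trans AB (@sub_gen B)). Qed.

Lemma gen_id S : subfield_set S -> gen S = S.
Proof. by move=> hS; rewrite eqEsubset; split; [apply: gen_min|apply: sub_gen]. Qed.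

Lemma gen_idU A B : gen (gen A `|` B) = gen (A `|` B).
Proof.
rewrite eqEsubset; split.
  apply: gen_min (gen_subfield _) _ => x [|Bx]; last by apply: sub_gen; right.
  by apply: gen_mono => y; left.
by apply: gen_mono => x [Ax|Bx]; [left; apply: sub_gen|right].
Qed.

Lemma subfieldW S : subfield_set S -> subring_set S.
Proof.
case=> S1 SB SV; split=> // x y Sx Sy.
by rewrite -[y]invrK; apply: (SV) => //; rewrite -[y^-1]mul1r; apply: SV.
Qed.

Lemma subring0 S : subring_set S -> S 0.
Proof. by case=> S1 SB _; rewrite -(subrr 1); apply: SB. Qed.

Lemma subringN S x : subring_set S -> S x -> S (- x).
Proof. by move=> hS Sx; rewrite -sub0r; case: (hS) => _ SB _; apply: SB => //; exact: subring0. Qed.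

Lemma subringD S x y : subring_set S -> S x -> S y -> S (x + y).
Proof. by move=> hS Sx Sy; rewrite -[y]opprK; case: (hS) => _ SB _; apply: SB => //; exact: subringN. Qed.

Lemma subringM S x y : subring_set S -> S x -> S y -> S (x * y).
Proof. by case=> _ _; apply. Qed.

Lemma subringX S x n : subring_set S -> S x -> S (x ^+ n).
Proof.
move=> hS Sx; elim: n => [|n IH]; first by rewrite expr0; case: hS.
by rewrite exprS; apply: subringM.
Qed.

Lemma subring_sum S (I : Type) (r : seq I) (P : pred I) F : subring_set S ->
  (forall i, P i -> S (F i)) -> S (\sum_(i <- r | P i) F i).
Proof.
move=> hS; apply: big_ind; first exact: subring0.
by move=> x y; apply: subringD.
Qed.

Lemma subring_prod S (I : Type) (r : seq I) (P : pred I) F : subring_set S ->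
  (forall i, P i -> S (F i)) -> S (\prod_(i <- r | P i) F i).
Proof.
move=> hS; apply: big_ind; first by case: hS.
by move=> x y; apply: subringM.
Qed.

Lemma subfieldV S x : subfield_set S -> S x -> S x^-1.
Proof. by case=> S1 _ SV Sx; rewrite -[x^-1]mul1r; apply: SV. Qed.

(** A divring-closed predicate packed as a structure carries enough information
    to make its subtype a field by inheritance.  *)
Section SubType.
Variable S : divringClosed L.
Definition sub_of : Type := {x : L | x \in S}.
HB.instance Definition _ := SubChoice.on sub_of.
HB.instance Definition _ := [SubChoice_isSubIntegralDomain of sub_of by <:].
HB.instance Definition _ := [SubIntegralDomain_isSubField of sub_of by <:].
End SubType.

(** The subfield is presented by an abstract field and an embedding, so that later
    proofs use coefficients in a type instead of coefficients in a set.  *)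
Lemma subfield_fieldType S : subfield_set S ->
  exists (D : fieldType) (i : {rmorphism D -> L}), forall x, S x <-> exists y : D, i y = x.
Proof.
move=> [S1 SB SV].
have hS : GRing.divring_closed [pred y | y \in S].
  by split=> [|u v|u v]; rewrite ?inE; [|apply: SB|apply: SV].
pose mx := GRing.isDivringClosed.Build L [pred y | y \in S] hS.
pose T : divringClosed L := HB.pack ([pred y | y \in S] : L -> bool) mx.
exists (sub_of T), (val : sub_of T -> L) => x; split=> [Sx|[[y Sy] <-]].
  have xT : x \in T by apply: mem_set.
  by exists (Sub x xT); exact: SubK.
exact: set_mem Sy.
Qed.

Lemma algebraic_overP S (D : fieldType) (i : {rmorphism D -> L}) :
  (forall x, S x <-> exists y : D, i y = x) ->
  forall x, algebraic_over S x <-> algebraicOver i x.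
Proof.
move=> hi x; split=> [[P [P0 SP rP]]|[P P0 rP]].
  have /choice[c hc] n : exists y : D, i y = P`_n by apply/hi.
  have eP : P = map_poly i (\poly_(n < size P) c n).
    apply/polyP=> n; rewrite coef_map coef_poly /=; case: ltnP => [_|h]; first by symmetry; apply: hc.
    by rewrite rmorph0 nth_default.
  by exists (\poly_(n < size P) c n); [move: P0; rewrite {1}eP map_poly_eq0|rewrite -eP].
exists (map_poly i P); split=> //; rewrite ?map_poly_eq0 // => n.
by rewrite coef_map /=; apply/hi; exists P`_n.
Qed.

Lemma sub_acl A : A `<=` acl A.
Proof.
move=> x Ax; exists ('X - x%:P); split; rewrite ?polyXsubC_eq0 ?root_XsubC // => i.
have hS := subfieldW (gen_subfield A).
rewrite coefB coefX coefC; case: (hS) => h1 hB _; apply: hB; first by case: eqP => // _; exact: subring0.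
by case: eqP => // _; [exact: sub_gen|exact: subring0].
Qed.

Lemma acl_mono A B : A `<=` B -> acl A `<=` acl B.
Proof. by move=> /gen_mono AB x [P [P0 hP rP]]; exists P; split=> // i; apply: AB. Qed.

Lemma acl_gen A : acl (gen A) = acl A.
Proof. by rewrite /acl gen_id //; exact: gen_subfield. Qed.

Lemma acl_genU A B : acl (gen A `|` B) = acl (A `|` B).
Proof. by rewrite /acl gen_idU. Qed.

Lemma acl_subfield A : subfield_set (acl A).
Proof.
have [D [i hi]] := subfield_fieldType (gen_subfield A).
have h := algebraic_overP hi; rewrite /acl.
split=> [|x y /h hx /h hy|x y /h hx /h hy]; apply/h.
- exact: algebraic1.
- exact: algebraic_sub.
- exact: algebraic_div.
Qed.

(** Transitivity of algebraicity, in the form given by integral dependence: over a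
    subfield, algebraic and integral elements coincide, and the latter are closed
    under taking roots.  *)
Lemma acl_root A (P : {poly L}) x :
  P != 0 -> (forall i, acl A P`_i) -> root P x -> acl A x.
Proof.
have [D [i hi]] := subfield_fieldType (gen_subfield A).
have h := algebraic_overP hi; rewrite /acl => P0 hP rP.
apply/h/integral_algebraic; apply: integral_root P0 rP _ => y /(nthP 0)[n _ <-].
exact/integral_algebraic/h.
Qed.

Lemma acl_min A B : A `<=` acl B -> acl A `<=` acl B.
Proof.
move=> AB x [P [P0 hP rP]]; apply: acl_root P0 _ rP => i.
by apply: gen_min (acl_subfield B) AB _ (hP i).
Qed.

(** Every element of the subfield generated by A is a fraction over R0, and a
    polynomial has finitely many coefficients, hence a common denominator.  *)
Lemma acl_clear A R0 x : subring_set R0 -> A `<=` R0 -> acl A x ->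
  exists P : {poly L}, [/\ P != 0, forall i, R0 P`_i & root P x].
Proof.
move=> hR AR [P [P0 hP rP]].
have frac y : gen A y -> exists d, [/\ d != 0, R0 d & R0 (d * y)].
  apply: (@gen_min A [set y | exists d, [/\ d != 0, R0 d & R0 (d * y)]]); last first.
    move=> z /AR Rz; exists 1; rewrite oner_eq0 mul1r; split=> //; by case: hR.
  split=> [|u v [d [d0 Rd Rdu]] [e [e0 Re Rev]]|u v [d [d0 Rd Rdu]] [e [e0 Re Rev]]] /=.
  - by exists 1; rewrite oner_eq0 mul1r; case: hR.
  - exists (d * e); rewrite mulf_neq0 //; split=> //; first exact: subringM.
    rewrite mulrBr {1}[d * e]mulrC -!mulrA.
    by case: (hR) => _ hB _; apply: hB; apply: subringM.
  - have [->|v0] := eqVneq v 0.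
      by exists 1; rewrite oner_eq0 mul1r invr0 mulr0; split=> //; [case: hR|exact: subring0].
    exists (d * (e * v)); rewrite !mulf_neq0 //; split=> //; first exact: subringM.
    have -> : d * (e * v) * (u / v) = (d * u) * e.
      by field.
    exact: subringM.
have [d [d0 Rd hd]] : exists d, [/\ d != 0, R0 d & forall i, (i < size P)%N -> R0 (d * P`_i)].
  elim: (size P) => [|n [d [d0 Rd hd]]]; first by exists 1; rewrite oner_eq0; split=> //; case: hR.
  have [e [e0 Re he]] := frac _ (hP n).
  exists (d * e); rewrite mulf_neq0 //; split=> //; first exact: subringM.
  move=> i; rewrite ltnS leq_eqVlt => /orP[/eqP->|/hd].
    by rewrite -mulrA; apply: subringM.
  by move=> h; rewrite -mulrAC; apply: subringM.
exists (d *: P); rewrite scaler_eq0 negb_or d0 P0; split=> // [i|].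
  rewrite coefZ; case: (ltnP i (size P)) => [/hd //|h].
  by rewrite nth_default // mulr0; exact: subring0.
by rewrite rootZ.
Qed.

(** Finite character: an element of a generated subfield only needs finitely many
    generators, and so do the finitely many coefficients of a polynomial.  *)
Lemma acl_fin A B x : acl (A `|` B) x ->
  exists s : seq L, (forall y, y \in s -> B y) /\ acl (A `|` [set` s]) x.
Proof.
move=> [P [P0 hP rP]].
have fin y : gen (A `|` B) y ->
    exists s : seq L, (forall y, y \in s -> B y) /\ gen (A `|` [set` s]) y.
  have mono (s t u : seq L) z : {subset s <= u} -> gen (A `|` [set` s]) z -> gen (A `|` [set` u]) z.
    move=> su; apply: gen_mono => w [Aw|]; [by left|by right; apply: su].
  apply: (@gen_min _ [set y | exists s : seq L,
    (forall y, y \in s -> B y) /\ gen (A `|` [set` s]) y]); last first.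
    move=> z [Az|Bz]; first by exists [::]; split=> //; apply: sub_gen; left.
    exists [:: z]; split=> [w|]; first by rewrite inE => /eqP->.
    by apply: sub_gen; right; rewrite /= inE.
  have cat_ok (s t : seq L) : (forall y, y \in s -> B y) -> (forall y, y \in t -> B y) ->
      forall y, y \in s ++ t -> B y.
    by move=> Bs Bt w; rewrite mem_cat => /orP[/Bs|/Bt].
  have subl (s t : seq L) : {subset s <= s ++ t} by move=> w h; rewrite mem_cat h.
  have subr (s t : seq L) : {subset t <= s ++ t} by move=> w h; rewrite mem_cat h orbT.
  split=> [|u v [s [Bs us]] [t [Bt vt]]|u v [s [Bs us]] [t [Bt vt]]].
  - by exists [::]; split=> //; case: (gen_subfield (A `|` [set` [::]])).
  - exists (s ++ t); split; first exact: cat_ok.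
    by case: (gen_subfield (A `|` [set` s ++ t])) => _ h _; apply: h; [apply: mono us|apply: mono vt].
  - exists (s ++ t); split; first exact: cat_ok.
    by case: (gen_subfield (A `|` [set` s ++ t])) => _ _ h; apply: h; [apply: mono us|apply: mono vt].
have /choice[f hf] i := fin _ (hP i).
pose s := flatten [seq f i | i <- iota 0 (size P)].
exists s; split=> [y /flatten_mapP[i _ yf]|]; first by case: (hf i) => h _; apply: h.
exists P; split=> // i; have [h|h] := ltnP i (size P); last first.
  by rewrite nth_default //; apply: (subring0 (subfieldW (gen_subfield _))).
apply: gen_mono (hf i).2 => w [Aw|wf]; [by left|right].
by apply/flatten_mapP; exists i => //; rewrite mem_iota.
Qed.

End Subfields.

Section Morphism.
Variables (L L' : fieldType) (i : {rmorphism L -> L'}).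

Lemma gen_morph (A : set L) : gen (i @` A) = i @` gen A.
Proof.
rewrite eqEsubset; split.
  apply: gen_min; last by move=> _ [x Ax <-]; exists x => //; apply: sub_gen.
  have [h1 hB hV] := gen_subfield A.
  split=> [|_ _ [x hx <-] [y hy <-]|_ _ [x hx <-] [y hy <-]].
  - by exists 1; rewrite ?rmorph1.
  - by exists (x - y); rewrite ?rmorphB //; apply: hB.
  - by exists (x / y); rewrite ?fmorph_div //; apply: hV.
move=> _ [x + <-]; apply: (@gen_min _ A [set x | gen (i @` A) (i x)]).
  have [h1 hB hV] := gen_subfield (i @` A).
  split=> [|u v hu hv|u v hu hv] /=.
  - by rewrite rmorph1.
  - by rewrite rmorphB; apply: hB.
  - by rewrite fmorph_div; apply: hV.
by move=> y Ay; apply: sub_gen; exists y.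
Qed.

Lemma acl_morph (A : set L) x : acl (i @` A) (i x) <-> acl A x.
Proof.
rewrite /acl gen_morph; split=> [[P [P0 hP rP]]|[P [P0 hP rP]]].
  have /choice[c hc] n : exists y, gen A y /\ i y = P`_n by have [y] := hP n; exists y.
  have eP : P = map_poly i (\poly_(n < size P) c n).
    apply/polyP=> n; rewrite coef_map coef_poly /=; case: ltnP => [_|h]; first by symmetry; case: (hc n).
    by rewrite rmorph0 nth_default.
  exists (\poly_(n < size P) c n); split.
  - by move: P0; rewrite {1}eP map_poly_eq0.
  - move=> n; rewrite coef_poly; case: ifP => _; first by case: (hc n).
    by apply: (subring0 (subfieldW (gen_subfield _))).
  - by move: rP; rewrite {1}eP fmorph_root.
exists (map_poly i P); rewrite map_poly_eq0 fmorph_root; split=> // n.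
by rewrite coef_map /=; exists P`_n.
Qed.

End Morphism.

(** * Algebraic independence and relative algebraic closure *)

Section Muni.
Variables (D : comNzRingType) (S : comNzRingType) (f : {rmorphism D -> S}) (n : nat).

(** Evaluating the variables of a polynomial can be done in two steps, the last
    variable coming second; [muni] regards it as the only one.  *)
Lemma mmap_muni (a : 'I_n.+1 -> S) (Q : {mpoly D[n.+1]}) :
  mmap f a Q = (map_poly (mmap f (fun j => a (widen_ord (leqnSn n) j))) (muni Q)).[a ord_max].
Proof.
rewrite muniE rmorph_sum /= horner_sum; apply: eq_bigr => m _.
rewrite map_polyZ /= map_polyXn hornerZ hornerXn mmapZ mmapX -mulrA; congr (_ * _).
rewrite /mmap1 big_ord_recr /=; congr (_ * _); apply: eq_bigr => j _.
by rewrite mnmE.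
Qed.

End Muni.

(** Evaluation at the variables themselves is the identity, and by [mmap_muni] it
    factors through [muni].  *)
Lemma muni_eq0 (D : comNzRingType) n (Q : {mpoly D[n.+1]}) : muni Q = 0 -> Q = 0.
Proof.
move=> Q0; have := mmap_muni (@mpolyC n.+1 D) (fun j => 'X_j) Q.
rewrite Q0 rmorph0 horner0 => <-; rewrite [LHS]mpolyE; apply: eq_bigr => m _.
by rewrite mmap1_id mul_mpolyC.
Qed.

Section Independence.
Variables (L D : fieldType) (i : {rmorphism D -> L}).

Lemma meval_map_mpoly n (a : 'I_n -> L) (Q : {mpoly D[n]}) :
  (map_mpoly i Q).@[a] = mmap i a Q.
Proof.
rewrite /map_mpoly /mmap rmorph_sum /=; apply: eq_bigr => m _.
by rewrite mevalM mevalC mmap1_id mevalX.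
Qed.

(** Polynomials with coefficients in the set k are the images of polynomials over a
    field D that parametrizes k.  *)
Lemma alg_independent_mmapP k n (a : 'I_n -> L) :
  (forall x, k x <-> exists y : D, i y = x) ->
  alg_independent k a <-> forall Q : {mpoly D[n]}, mmap i a Q = 0 -> Q = 0.
Proof.
move=> hi; split=> [h Q Qa|h P kP Pa].
  have /mpolyP e : map_mpoly i Q = 0.
    apply: h; first by move=> m; rewrite mcoeff_map_mpoly; apply/hi; exists Q@_m.
    by rewrite -[RHS]Qa meval_map_mpoly.
  apply/mpolyP=> m; apply/(fmorph_inj i); rewrite mcoeff0 rmorph0.
  by have := e m; rewrite mcoeff0 mcoeff_map_mpoly.
have /choice[c hc] := fun m => (hi _).1 (kP m).
pose Q : {mpoly D[n]} := \sum_(m <- msupp P) c m *: 'X_[m].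
have eP : P = map_mpoly i Q.
  transitivity (\sum_(m <- msupp P) map_mpoly i (c m *: 'X_[m])); last by rewrite /Q raddf_sum.
  by rewrite {1}[P]mpolyE; apply: eq_bigr => m _; rewrite map_mpolyZ map_mpolyX hc.
rewrite eP (h Q) ?rmorph0 //; by rewrite -meval_map_mpoly -eP.
Qed.

Definition others n (a : 'I_n -> L) (j : 'I_n) : set L := [set a l | l in [set l | l != j]].

(** Substituting all variables but the j-th by their values gives a map E from
    polynomials in n variables to L[X].  The constants in its image form a ring
    that contains k and the other a l, so after clearing denominators an algebraic
    equation for a j over them has the form E Q, with Q a relation between all the
    a l.  *)
Lemma independent_notin_acl k n (a : 'I_n -> L) : 
  (forall x, k x <-> exists y : D, i y = x) ->
  (forall Q : {mpoly D[n]}, mmap i a Q = 0 -> Q = 0) ->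
  forall j, ~ acl (k `|` others a j) (a j).
Proof.
move=> hi h j.
pose E := mmap (polyC \o i : {rmorphism D -> {poly L}})
   (fun l => if l == j then 'X else (a l)%:P) : {rmorphism {mpoly D[n]} -> {poly L}}.
pose R0 := [set c : L | exists Q, E Q = c%:P].
have hR : subring_set R0.
  split=> [|x y [P eP] [Q eQ]|x y [P eP] [Q eQ]].
  - by exists 1; rewrite rmorph1.
  - by exists (P - Q); rewrite rmorphB eP eQ polyCB.
  - by exists (P * Q); rewrite rmorphM eP eQ polyCM.
have EX l : E 'X_l = if l == j then 'X else (a l)%:P by rewrite /E /= mmapX mmap1U.
have kR : k `|` others a j `<=` R0.
  move=> x [/hi[c <-]|[l /= lj <-]]; first by exists c%:MP; rewrite /E /= mmapC.
  by exists 'X_l; rewrite EX (negbTE lj).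
move=> /(acl_clear hR kR)[P [P0 hP rP]].
have [Q eQ] : exists Q, E Q = P.
  have /choice[c hc] := hP.
  exists (\sum_(l < size P) c l * 'X_j ^+ l).
  rewrite rmorph_sum -[RHS]coefK poly_def /=; apply: eq_bigr => l _.
  by rewrite -mul_polyC rmorphM rmorphXn /= hc EX eqxx.
have Ea Q' : (E Q').[a j] = mmap i a Q'.
  rewrite /E /= [mmap _ _ Q']/mmap horner_sum; apply: eq_bigr => m _.
  rewrite hornerM hornerC /=; congr (_ * _); rewrite horner_prod; apply: eq_bigr => l _.
  by rewrite horner_exp; congr (_ ^+ _); case: eqP => [->|]; rewrite ?hornerX ?hornerC.
have Q0 : Q = 0 by apply: h; rewrite -Ea eQ; apply/rootP.
by move: P0; rewrite -eQ Q0 rmorph0 eqxx.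
Qed.

(** Induction on the number of variables: in a relation regarded as a polynomial in
    the last variable, the coefficients must vanish at the other elements, since
    the last one does not depend algebraically on them.  *)
Lemma notin_acl_independent k n (a : 'I_n -> L) : 
  (forall x, k x <-> exists y : D, i y = x) ->
  (forall j, ~ acl (k `|` others a j) (a j)) ->
  (forall Q : {mpoly D[n]}, mmap i a Q = 0 -> Q = 0).
Proof.
move=> hi; elim: n a => [|n IH] a h Q Qa.
  have eQ : Q = (Q@_0)%:MP.
    apply/mpolyP=> m; rewrite mcoeffC; have -> : m = 0%MM by apply/mnmP=> - [].
    by rewrite eqxx mulr1.
  move: Qa; rewrite eQ mmapC => /eqP; rewrite fmorph_eq0 => /eqP->.
  by rewrite mpolyC0.
pose w := widen_ord (leqnSn n); pose b j := a (w j).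
have hgen : subfield_set (gen (k `|` others a ord_max)) by exact: gen_subfield.
have sgen := subfieldW hgen.
have genb Q' : gen (k `|` others a ord_max) (mmap i b Q').
  rewrite /mmap; apply: (subring_sum _ sgen) => m _; apply: (subringM sgen).
    by apply: sub_gen; left; apply/hi; exists Q'@_m.
  apply: (subring_prod _ sgen) => l _; apply: (subringX _ sgen); apply: sub_gen; right.
  by exists (w l) => //=; rewrite -val_eqE /= ltn_eqF.
have Q0 : map_poly (mmap i b) (muni Q) = 0.
  apply: contrapT => /eqP P0; apply: (h ord_max); exists (map_poly (mmap i b) (muni Q)).
  split=> // [l|]; first by rewrite coef_map /=; exact: genb.
  by apply/rootP; rewrite -mmap_muni.
apply: muni_eq0; apply/polyP=> l; rewrite coef0; apply: (IH b).
  move=> j hj; apply: (h (w j)); apply: acl_mono hj => x [kx|[l' lj <-]]; [by left|right].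
  by exists (w l').
by have := congr1 (fun p : {poly L} => p`_l) Q0; rewrite coef_map coef0.
Qed.

End Independence.

Lemma alg_independentP (L : fieldType) (k : set L) n (a : 'I_n -> L) : subfield_set k ->
  alg_independent k a <-> forall j, ~ acl (k `|` others a j) (a j).
Proof.
move=> /subfield_fieldType[D [i hi]].
rewrite (alg_independent_mmapP a hi); split.
  exact: independent_notin_acl.
exact: notin_acl_independent.
Qed.

(** * Maximal sets and morphisms from functions *)

(** The form of Zorn's lemma used for partial morphisms, which are never empty and
    only stable under unions of nonempty chains.  *)
Lemma Zorn_chain (T : Type) (P : set (set T)) (A0 : set T) : P A0 ->
  (forall F : set (set T), F `<=` P -> F !=set0 -> total_on F subset ->
     P (\bigcup_(X in F) X)) ->
  exists A, P A /\ forall B, P B -> A `<=` B -> B `<=` A.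
Proof.
move=> PA0 hP; pose Q (X : set T) := X = set0 \/ P X.
have [F FQ tot|A [QA maxA]] := @Zorn_bigcup _ Q.
  have eF : \bigcup_(X in F) X = \bigcup_(X in F `&` P) X.
    rewrite eqEsubset; split=> x [X FX Xx]; last by exists X => //; case: FX.
    by have [X0|PX] := FQ _ FX; [rewrite X0 in Xx|exists X].
  have [F0|/set0P F0] := eqVneq (F `&` P) set0.
    by left; rewrite eF F0 bigcup_set0.
  right; rewrite eF; apply: (hP) => [X []||] //.
  by move=> X Y [FX _] [FY _]; apply: tot.
have PA : P A.
  case: QA => // A_0; have [<-//|A00] := pselect (A0 = A).
  case: (maxA A0); last by right.
  by split=> [|h]; [rewrite A_0|apply: A00; apply/seteqP; split; [|rewrite A_0]].
exists A; split=> // B PB AB; apply: contrapT => BA.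
by apply: (maxA B); [split|right].
Qed.

Lemma rmorphism_of (R S : nzRingType) (f : R -> S) :
  zmod_morphism f -> monoid_morphism f -> exists g : {rmorphism R -> S}, forall x, g x = f x.
Proof.
move=> fB fM; pose m1 := GRing.isZmodMorphism.Build _ _ f fB.
pose m2 := GRing.isMonoidMorphism.Build _ _ f fM.
pose g : {rmorphism R -> S} := HB.pack f m1 m2.
by exists g.
Qed.

(** * Partial isomorphisms of fields *)

Section PartialIso.
Variables L L' : fieldType.
Implicit Types (G : set (L * L')) (D : fieldType).

(** The graph of an isomorphism between a subring of L and a subring of L'; the last
    clause makes the relation functional and injective.  Graphs are preferred to
    functions on subfields because unions of chains of graphs are plain unions.  *)
Definition subring_rel G :=
  [/\ G (1, 1),
      forall x x' y y', G (x, x') -> G (y, y') -> G (x - y, x' - y'),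
      forall x x' y y', G (x, x') -> G (y, y') -> G (x * y, x' * y')
    & forall x x', G (x, x') -> (x = 0 <-> x' = 0)].

Definition partial_iso G :=
  subring_rel G /\ forall x x', G (x, x') -> G (x^-1, x'^-1).

Definition dom_rel G : set L := [set x | exists y, G (x, y)].
Definition ran_rel G : set L' := [set y | exists x, G (x, y)].

Definition frac_rel G : set (L * L') :=
  [set p | exists u v u' v', [/\ G (u, u'), G (v, v') & p = (u / v, u' / v')]].

Lemma sub_frac_rel G : subring_rel G -> G `<=` frac_rel G.
Proof. by move=> [G1 _ _ _] [x y] Gxy; exists x, 1, y, 1; rewrite !divr1. Qed.

(** An isomorphism of domains extends to their fields of fractions.  *)
Lemma frac_rel_iso G : subring_rel G -> partial_iso (frac_rel G).
Proof.
move=> hG; case: (hG) => G1 GB GM G0.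
have Gz : G (0, 0) by have := GB _ _ _ _ G1 G1; rewrite !subrr.
have iff0 x x' : G (x, x') -> (x == 0) = (x' == 0).
  by move=> /G0 h; apply/eqP/eqP => /h.
(* A fraction with zero denominator is 0, so denominators may be taken nonzero. *)
have nz u v u' v' : G (u, u') -> G (v, v') -> exists w w' t t',
   [/\ G (w, w'), G (t, t'), t != 0, t' != 0 & (u / v, u' / v') = (w / t, w' / t')].
  move=> Gu Gv; have [v0|v0] := eqVneq v 0.
    have v0' : v' = 0 by apply/(G0 _ _ Gv).
    by exists 0, 0, 1, 1; rewrite v0 v0' !invr0 !mulr0 !mul0r !oner_neq0.
  by exists u, u', v, v'; rewrite -(iff0 _ _ Gv) v0.
split; first split.
- exact: sub_frac_rel.
- move=> _ _ _ _ [u1 [v1 [u1' [v1' [Gu Gv [-> ->]]]]]] [u2 [v2 [u2' [v2' [Gw Gt [-> ->]]]]]].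
  have [w [w' [t [t' [Gw1 Gt1 t0 t0' [-> ->]]]]]] := nz _ _ _ _ Gu Gv.
  have [x [x' [y [y' [Gx Gy y0 y0' [-> ->]]]]]] := nz _ _ _ _ Gw Gt.
  exists (w * y - x * t), (t * y), (w' * y' - x' * t'), (t' * y').
  split; [by apply: GB; apply: GM|exact: GM|].
  by congr (_, _); field; rewrite ?t0 ?y0 ?t0' ?y0'.
- move=> _ _ _ _ [u [v [u' [v' [Gu Gv [-> ->]]]]]] [w [t [w' [t' [Gw Gt [-> ->]]]]]].
  exists (u * w), (v * t), (u' * w'), (v' * t'); split; try exact: GM.
  by rewrite !mulf_div.
- move=> _ _ [u [v [u' [v' [Gu Gv [-> ->]]]]]].
  have e : (u / v == 0) = (u' / v' == 0).
    by rewrite !mulf_eq0 !invr_eq0 (iff0 _ _ Gu) (iff0 _ _ Gv).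
  by split=> /eqP h; apply/eqP; move: h; rewrite e.
- move=> _ _ [u [v [u' [v' [Gu Gv [-> ->]]]]]].
  by exists v, u, v', u'; rewrite !invf_div.
Qed.

(** A partial isomorphism amounts to two embeddings of one field, which makes the
    polynomials over its domain available.  *)
Lemma partial_iso_field G : partial_iso G ->
  exists D (i : {rmorphism D -> L}) (j : {rmorphism D -> L'}),
    forall x y, G (x, y) <-> exists d, x = i d /\ y = j d.
Proof.
move=> [[G1 GB GM G0] GV].
have fG x y y' : G (x, y) -> G (x, y') -> y = y'.
  move=> h h'; have := GB _ _ _ _ h h'; rewrite subrr => /G0 -[/(_ erefl) h0 _].
  by apply/eqP; rewrite -subr_eq0 h0.
have [|D [i hi]] := @subfield_fieldType L (dom_rel G).
  split=> [|x y [x' Gx] [y' Gy]|x y [x' Gx] [y' Gy]]; first by exists 1.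
    by exists (x' - y'); apply: GB.
  by exists (x' / y'); apply: GM => //; apply: GV.
have /choice[f hf] : forall d : D, exists y, G (i d, y) by move=> d; apply/hi; exists d.
have [||j hj] := @rmorphism_of D L' f.
- by move=> x y; apply: fG (hf _) _; rewrite rmorphB; apply: GB.
- split; first by apply: fG (hf _) _; rewrite rmorph1.
  by move=> x y; apply: fG (hf _) _; rewrite rmorphM; apply: GM.
exists D, i, j => x y; split=> [Gxy|[d [-> ->]]]; last by rewrite hj.
have /hi[d ed] : dom_rel G x by exists y.
by exists d; split=> //; apply: fG Gxy _; rewrite -ed hj.
Qed.

Section Extend.
Variables (D : fieldType) (i : {rmorphism D -> L}) (j : {rmorphism D -> L'}).

(** The condition under which an isomorphism from i(D) to j(D) extends by sending
    a to b.  *)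
Definition conjugate a b := forall p : {poly D},
  root (map_poly i p) a <-> root (map_poly j p) b.

Definition adjoin_rel a b : set (L * L') :=
  frac_rel [set q | exists p : {poly D}, q = ((map_poly i p).[a], (map_poly j p).[b])].

Lemma adjoin_subring a b : conjugate a b ->
  subring_rel [set q | exists p : {poly D}, q = ((map_poly i p).[a], (map_poly j p).[b])].
Proof.
move=> hab; split.
- by exists 1; rewrite !rmorph1 !hornerC.
- move=> x x' y y' [p [-> ->]] [q [-> ->]]; exists (p - q).
  by rewrite !rmorphB !hornerD !hornerN.
- move=> x x' y y' [p [-> ->]] [q [-> ->]]; exists (p * q).
  by rewrite !rmorphM !hornerM.
- by move=> x x' [p [-> ->]]; split=> /rootP/hab/rootP.
Qed.

Lemma adjoin_iso a b : conjugate a b -> partial_iso (adjoin_rel a b).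
Proof. by move=> /adjoin_subring/frac_rel_iso. Qed.

Lemma adjoin_base a b d : conjugate a b -> adjoin_rel a b (i d, j d).
Proof.
move=> hab; apply: (sub_frac_rel (adjoin_subring hab)).
by exists d%:P; rewrite !map_polyC !hornerC.
Qed.

Lemma adjoin_gen a b : conjugate a b -> adjoin_rel a b (a, b).
Proof.
move=> hab; apply: (sub_frac_rel (adjoin_subring hab)).
by exists 'X; rewrite !map_polyX !hornerX.
Qed.

End Extend.

Lemma horner_subring D (i : {rmorphism D -> L}) (S : set L) (p : {poly D}) a :
  subring_set S -> (forall d, S (i d)) -> S a -> S (map_poly i p).[a].
Proof.
move=> hS Si Sa; rewrite horner_coef; apply: (subring_sum _ hS) => l _.
by apply: (subringM hS); [rewrite coef_map; exact: Si|exact: subringX].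
Qed.

End PartialIso.

Lemma adjoin_dom (L L' D : fieldType) (i : {rmorphism D -> L}) (j : {rmorphism D -> L'})
  (S : set L) a b x y :
  subfield_set S -> (forall d, S (i d)) -> S a -> adjoin_rel i j a b (x, y) -> S x.
Proof.
move=> hS Si Sa [u [v [u' [v' [[p [-> _]] [q [-> _]] [-> _]]]]]].
by case: (hS) => _ _; apply; apply: horner_subring => //; apply: subfieldW.
Qed.

Lemma adjoin_ran (L L' D : fieldType) (i : {rmorphism D -> L}) (j : {rmorphism D -> L'})
  (S : set L') a b x y :
  subfield_set S -> (forall d, S (j d)) -> S b -> adjoin_rel i j a b (x, y) -> S y.
Proof.
move=> hS Si Sa [u [v [u' [v' [[p [_ ->]] [q [_ ->]] [_ ->]]]]]].
by case: (hS) => _ _; apply; apply: horner_subring => //; apply: subfieldW.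
Qed.

Lemma transcendental_conjugate (L L' D : fieldType) (i : {rmorphism D -> L})
  (j : {rmorphism D -> L'}) a b :
  ~ algebraicOver i a -> ~ algebraicOver j b -> conjugate i j a b.
Proof.
move=> ha hb p; have [->|p0] := eqVneq p 0; first by rewrite !rmorph0 !root0.
by split=> rp; [case: ha|case: hb]; exists p.
Qed.

(** Take for b a root of the image of a polynomial m of least degree that vanishes
    at a.  For any p, the gcd g of m and p either vanishes at a, and then m divides
    p, or is constant by minimality of m, and then a Bezout relation prevents p from
    vanishing at a common root with m.  *)
Lemma algebraic_conjugate (L D : fieldType) (L' : closedFieldType) (i : {rmorphism D -> L})
  (j : {rmorphism D -> L'}) a :
  algebraicOver i a -> exists b, algebraicOver j b /\ conjugate i j a b.
Proof.
move=> [p0 p00 rp0].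
have exm : exists n, `[< exists m : {poly D}, [/\ m != 0, root (map_poly i m) a & size m = n] >].
  by exists (size p0); apply/asboolP; exists p0.
have [_ /asboolP[m [m0 rm <-]] min] := ex_minnP exm.
have minm q : q != 0 -> root (map_poly i q) a -> (size m <= size q)%N.
  by move=> q0 rq; apply: min; apply/asboolP; exists q.
have sm : size (map_poly j m) != 1.
  rewrite size_map_poly; apply/negP => /size_poly1P[c c0 em].
  by move: rm; rewrite em map_polyC /= rootC fmorph_eq0 (negbTE c0).
have [b rb] := closed_rootP _ sm.
have bP : algebraicOver j b by exists m.
exists b; split=> // p.
pose g := gcdp m p.
have [h eh] : exists h, m = h * g by apply/dvdpP/dvdp_gcdl.
have [h0 g0] : h != 0 /\ g != 0 by apply/andP; rewrite -negb_or -mulf_eq0 -eh.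
have sz := size_mul h0 g0; rewrite -eh in sz.
have sh : (0 < size h)%N by rewrite size_poly_gt0.
have sg : (0 < size g)%N by rewrite size_poly_gt0.
have [rg|rg] := boolP (root (map_poly i g) a).
  have dmp : m %| p.
    have : (size m <= size g)%N by exact: minm.
    have /dvdp_leq : g %| m by apply: dvdp_gcdl.
    move=> /(_ m0) le1 le2; have : g %= m by rewrite -dvdp_size_eqp ?dvdp_gcdl // eqn_leq le1 le2.
    by move=> /eqp_dvdl <-; apply: dvdp_gcdr.
  by have /dvdpP[q ->] := dmp; rewrite !rmorphM !rootM rm rb !orbT.
have rh : root (map_poly i h) a by move: rm; rewrite eh rmorphM rootM (negbTE rg) orbF.
have sg1 : size g = 1%N.
  have : (size m <= size h)%N by exact: minm.
  rewrite sz; case: (size g) sg => // -[//|n] _; rewrite addnS /= addnS ltnNge leq_addr //.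
have cop : coprimep m p by rewrite /coprimep -/g sg1.
have /Bezout_eq1_coprimepP[[u v] /= e] := cop.
have key (E : fieldType) (f : {rmorphism D -> E}) c : root (map_poly f m) c -> ~ root (map_poly f p) c.
  move=> /rootP mc /rootP pc; have := congr1 (fun q => (map_poly f q).[c]) e.
  rewrite rmorphD !rmorphM /= hornerD !hornerM mc pc !mulr0 addr0 rmorph1 hornerC.
  by move/eqP; rewrite eq_sym oner_eq0.
by split=> rp; [case: (key _ _ _ rm rp)|case: (key _ _ _ rb rp)].
Qed.

(** * Steinitz's theorem *)

Section Steinitz.
Variables (L L' : closedFieldType) (G0 : set (L * L')).
Variables (B : set L) (B' : set L') (f : L -> L').
Hypothesis hG0 : subring_rel G0.
Let k := dom_rel G0.
Let k' := ran_rel G0.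
Hypothesis fB : forall b, B b -> B' (f b).
Hypothesis f_inj : forall b c, B b -> B c -> f b = f c -> b = c.
Hypothesis f_surj : forall b', B' b' -> exists2 b, B b & f b = b'.
Hypothesis indB : forall b, B b -> ~ acl (k `|` (B `\ b)) b.
Hypothesis indB' : forall b, B' b -> ~ acl (k' `|` (B' `\ b)) b.
Hypothesis spanB : forall x, acl (k `|` B) x.
Hypothesis spanB' : forall x, acl (k' `|` B') x.

Implicit Types G : set (L * L').

Let Cof G : set L := [set c | B c /\ G (c, f c)].

(** The bounds on the domain and the range keep the remaining basis elements
    transcendental over them, which is what allows a further basis element to be
    added.  *)
Let good G := [/\ partial_iso G, G0 `<=` G, dom_rel G `<=` acl (k `|` Cof G)
                 & ran_rel G `<=` acl (k' `|` f @` Cof G)].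

Let cofM G H : G `<=` H -> Cof G `<=` Cof H.
Proof. by move=> GH c [Bc Gc]; split=> //; apply: GH. Qed.

Let domM G H : G `<=` H -> acl (k `|` Cof G) `<=` acl (k `|` Cof H).
Proof. by move=> /cofM GH; apply: acl_mono => x [|/GH]; [left|right]. Qed.

Let ranM G H : G `<=` H -> acl (k' `|` f @` Cof G) `<=` acl (k' `|` f @` Cof H).
Proof.
move=> /cofM GH; apply: acl_mono => x [|[c /GH hc <-]]; [by left|right].
by exists c.
Qed.

Let good0 : good (frac_rel G0).
Proof.
split; [exact: frac_rel_iso|exact: sub_frac_rel| |].
  move=> x [y [u [v [u' [v' [Gu Gv [-> _]]]]]]].
  have [_ _ h] := acl_subfield (k `|` Cof (frac_rel G0)).
  by apply: h; apply: sub_acl; left; [exists u'|exists v'].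
move=> x [y [u [v [u' [v' [Gu Gv [_ ->]]]]]]].
have [_ _ h] := acl_subfield (k' `|` f @` Cof (frac_rel G0)).
by apply: h; apply: sub_acl; left; [exists u|exists v].
Qed.

Let good_chain (F : set (set (L * L'))) : F `<=` good -> F !=set0 ->
  total_on F subset -> good (\bigcup_(X in F) X).
Proof.
move=> Fg [X0 FX0] tot; set U := \bigcup_(X in F) X.
have sU X : F X -> X `<=` U by move=> FX; apply: bigcup_sup.
have two p q : U p -> U q -> exists X, [/\ F X, X p & X q].
  move=> [X FX Xp] [Y FY Yq]; case: (tot _ _ FX FY) => h.
    by exists Y; split=> //; apply: h.
  by exists X; split=> //; apply: h.
split.
- split; first split.
  + by apply: (sU _ FX0); case: (Fg _ FX0) => [[[]]].
  + move=> x x' y y' /two h /h[X [FX Xx Xy]]; apply: (sU _ FX).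
    by case: (Fg _ FX) => [[[_ + _ _] _] _ _ _]; apply.
  + move=> x x' y y' /two h /h[X [FX Xx Xy]]; apply: (sU _ FX).
    by case: (Fg _ FX) => [[[_ _ + _] _] _ _ _]; apply.
  + by move=> x x' [X FX Xx]; case: (Fg _ FX) => [[[_ _ _ +] _] _ _ _]; apply.
  + move=> x x' [X FX Xx]; apply: (sU _ FX).
    by case: (Fg _ FX) => [[_ +] _ _ _]; apply.
- by apply: subset_trans (sU _ FX0); case: (Fg _ FX0).
- move=> x [y [X FX Xy]]; apply: (domM (sU _ FX)).
  by case: (Fg _ FX) => _ _ + _; apply; exists y.
- move=> x [y [X FX Xy]]; apply: (ranM (sU _ FX)).
  by case: (Fg _ FX) => _ _ _; apply; exists y.
Qed.

(** A maximal good partial isomorphism contains all pairs (b, f b), as such a pair is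
    transcendental on both sides; every element is then algebraic over the domain,
    resp. the range, and [algebraic_conjugate] applies in both directions.  *)
Lemma steinitz : exists g : {rmorphism L -> L'},
  bijective g /\ forall u u', G0 (u, u') -> g u = u'.
Proof.
have [G [[piG G0G dG rG] maxG]] := Zorn_chain good0 good_chain.
have [D [i [j hij]]] := partial_iso_field piG.
have hi x : dom_rel G x <-> exists d, i d = x.
  split=> [[y /hij[d [-> _]]]|[d <-]]; first by exists d.
  by exists (j d); apply/hij; exists d.
have hj y : ran_rel G y <-> exists d, j d = y.
  split=> [[x /hij[d [_ ->]]]|[d <-]]; first by exists d.
  by exists (i d); apply/hij; exists d.
have algi x : algebraicOver i x -> acl (k `|` Cof G) x.
  move=> /(algebraic_overP hi)[P [P0 hP rP]].
  by apply: acl_root P0 _ rP => l; apply: dG.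
have algj y : algebraicOver j y -> acl (k' `|` f @` Cof G) y.
  move=> /(algebraic_overP hj)[P [P0 hP rP]].
  by apply: acl_root P0 _ rP => l; apply: rG.
(* By maximality, a matching pair is already in G, if adding it is compatible
   with the bounds: both elements are algebraic over them, or it is a pair (b, f b). *)
have ext a b : conjugate i j a b ->
    (acl (k `|` Cof G) a /\ acl (k' `|` f @` Cof G) b) \/ (B a /\ b = f a) -> G (a, b).
  move=> hab hor; pose H := adjoin_rel i j a b.
  have GH : G `<=` H by move=> [x y] /hij[d [-> ->]]; apply: adjoin_base.
  have Hab : H (a, b) by apply: adjoin_gen.
  suff gH : good H by apply: maxG gH GH _ Hab.
  split; [exact: adjoin_iso|exact: subset_trans GH| |].
    move=> x [y]; apply: adjoin_dom; first exact: acl_subfield.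
      by move=> d; apply: (domM GH); apply/dG/hi; exists d.
    case: hor => [[h _]|[Ba eb]]; first exact: domM h.
    by apply: sub_acl; right; split=> //; rewrite -eb.
  move=> y [x]; apply: adjoin_ran; first exact: acl_subfield.
    by move=> d; apply: (ranM GH); apply/rG/hj; exists d.
  case: hor => [[_ h]|[Ba eb]]; first exact: ranM h.
  by apply: sub_acl; right; exists a => //; split=> //; rewrite -eb.
have BC b : B b -> G (b, f b).
  move=> Bb; apply: contrapT => Gb; apply: (Gb); apply: ext; last by right.
  apply: transcendental_conjugate.
    move=> /algi h; apply: (indB Bb); apply: acl_mono h => x [|[Bx Gx]]; [by left|right].
    by split=> // e; apply: Gb; rewrite -e.
  move=> /algj h; apply: (indB' (fB Bb)); apply: acl_mono h => z.
  move=> [|[c [Bc Gc] ec]]; [by left|right; rewrite -ec].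
  by split; [exact: fB|move=> /= /f_inj e; apply: Gb; rewrite -e].
have domT x : exists d, i d = x.
  have ax : algebraicOver i x.
    apply/(algebraic_overP hi); have [P [P0 hP rP]] := spanB x.
    exists P; split=> // l; apply: gen_min (hP l); last first.
      move=> z [[y Gz]|Bz]; last by exists (f z); apply: BC.
      by exists y; apply: G0G.
    have [[G1 GB GM _] GV] := piG.
    split=> [|u v [u' Gu] [v' Gv]|u v [u' Gu] [v' Gv]]; first by exists 1.
      by exists (u' - v'); apply: GB.
    by exists (u' / v'); apply: GM => //; apply: GV.
  have [y [ay cxy]] := algebraic_conjugate j ax.
  apply/hi; exists y; apply: ext => //; left.
  by split; [exact: algi|exact: algj].
have ranT y : exists d, j d = y.
  have ay : algebraicOver j y.
    apply/(algebraic_overP hj); have [P [P0 hP rP]] := spanB' y.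
    exists P; split=> // l; apply: gen_min (hP l); last first.
      move=> z [[x Gz]|/f_surj[x Bx <-]]; last by exists x; apply: BC.
      by exists x; apply: G0G.
    have [[G1 GB GM _] GV] := piG.
    split=> [|u v [u' Gu] [v' Gv]|u v [u' Gu] [v' Gv]]; first by exists 1.
      by exists (u' - v'); apply: GB.
    by exists (u' / v'); apply: GM => //; apply: GV.
  have [x [ax cyx]] := algebraic_conjugate i ay.
  apply/hj; exists x; apply: ext; first by move=> p; split=> /cyx.
  by left; split; [exact: algi|exact: algj].
have /choice[c hc] := domT; have /choice[c' hc'] := ranT.
have ci d : c (i d) = d by apply: (fmorph_inj i); rewrite hc.
have cj d : c' (j d) = d by apply: (fmorph_inj j); rewrite hc'.
have [||g hg] := @rmorphism_of L L' (j \o c).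
- by move=> x y /=; rewrite -rmorphB; congr (j _); apply: (fmorph_inj i); rewrite rmorphB !hc.
- split=> [|x y] /=; first by rewrite -(rmorph1 i) ci rmorph1.
  by rewrite -rmorphM; congr (j _); apply: (fmorph_inj i); rewrite rmorphM !hc.
exists g; split.
  exists (i \o c') => x; first by rewrite hg /= cj hc.
  by rewrite hg /= ci hc'.
by move=> u u' /G0G/hij[d [-> ->]]; rewrite hg /= ci.
Qed.

End Steinitz.

(** * Algebraically closed subfields and ultrapowers *)

Lemma close_field (Q : fieldType) : GRing.closed_field_axiom Q ->
  exists (C : closedFieldType) (f : {rmorphism Q -> C}) (g : C -> Q), cancel f g /\ cancel g f.
Proof.
case: Q => T cT ax; pose m := Field_isAlgClosed.Build (GRing.Field.Pack cT) ax.
pose C : closedFieldType := HB.pack T cT m.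
by exists C, (idfun : {rmorphism C -> C}), id.
Qed.

(** A monic polynomial over acl A has a root in L, and this root is algebraic over
    acl A, hence lies in it.  *)
Lemma relative_closure (L : closedFieldType) (A : set L) :
  exists (C : closedFieldType) (i : {rmorphism C -> L}),
    forall x, acl A x <-> exists y, i y = x.
Proof.
have [D [i hi]] := subfield_fieldType (acl_subfield A).
have ax : GRing.closed_field_axiom D.
  move=> n P n0; have [x hx] := @GRing.solve_monicpoly L n (fun l => i (P l)) n0.
  pose p := 'X^n - \sum_(l < n) (i (P l)) *: 'X^l : {poly L}.
  have cp l : p`_l = (l == n)%:R - (if (l < n)%N then i (P l) else 0).
    rewrite coefB coefXn; congr (_ - _); rewrite -(poly_def n (fun l => i (P l))).
    by rewrite coef_poly.
  have /hi[y ey] : acl A x.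
    apply: (@acl_root _ A p).
    - apply/eqP => /polyP/(_ n); rewrite cp ltnn eqxx subr0 coef0 => /eqP.
      by rewrite oner_eq0.
    - move=> l; rewrite cp; have hS := subfieldW (acl_subfield A).
      case: (hS) => h1 hB _; apply: hB; first by case: eqP => // _; exact: subring0.
      by case: ifP => _; [apply/hi; exists (P l)|exact: subring0].
    - rewrite rootE hornerD hornerN hornerXn horner_sum subr_eq0 hx; apply/eqP.
      by apply: eq_bigr => l _; rewrite hornerZ hornerXn.
  exists y; apply: (fmorph_inj i); rewrite rmorphXn ey hx rmorph_sum; apply: eq_bigr => l _.
  by rewrite rmorphM rmorphXn ey.
have [C [f [g [fg gf]]]] := close_field ax.
have [||h hh] := @rmorphism_of C L (i \o g).
- move=> x y /=; rewrite -rmorphB; congr (i _); apply: (can_inj fg).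
  by rewrite rmorphB !gf.
- split=> [|x y] /=; first by rewrite -(rmorph1 f) fg rmorph1.
  by rewrite -rmorphM; congr (i _); apply: (can_inj fg); rewrite rmorphM !gf.
exists C, h => x; rewrite hi; split=> [[y <-]|[y <-]].
  by exists (f y); rewrite hh /= fg.
by exists (g y); rewrite hh.
Qed.

Local Open Scope quotient_scope.

Lemma quotient_field (R : comNzRingType) (S : {pred R}) : idealr_closed S ->
  (forall x, x \notin S -> exists y, y * x - 1 \in S) ->
  exists (Q : fieldType) (pi : {rmorphism R -> Q}),
    (forall q, exists r, pi r = q) /\ forall r, pi r = 0 <-> r \in S.
Proof.
move=> hS hV; pose I : idealr R := HB.pack (S : R -> bool) (isIdealr.Build R S hS).
pose Q := {ideal_quot I}.
have pi0 (r : R) : (\pi_Q r == 0) = (r \in S).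
  by rewrite -(rmorph0 (\pi_Q)) -Quotient.idealrBE subr0.
have /choice[inv hinv] (q : Q) : exists q' : Q, (q != 0 -> q' * q = 1) /\ (q = 0 -> q' = 0).
  have [q0|q0] := eqVneq q 0; first by exists 0.
  have [|y hy] := hV (repr q); first by rewrite -pi0 reprK.
  exists (\pi_Q y); split=> [_|e]; last by rewrite e eqxx in q0.
  apply/eqP; rewrite -subr_eq0.
  have -> : \pi_Q y * q - 1 = \pi_Q (y * repr q - 1) by rewrite rmorphB rmorphM rmorph1 /= reprK.
  by rewrite pi0.
have mV q : q != 0 -> inv q * q = 1 by case: (hinv q).
have i0 : inv 0 = 0 by case: (hinv 0) => _; apply.
pose F : fieldType := HB.pack Q (GRing.ComNzRing_isField.Build Q mV i0).
exists F, (\pi_Q : {rmorphism R -> Q}); split=> [q|r].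
  by exists (repr q); exact: (@reprK _ Q q).
by split=> [/eqP|h]; [rewrite pi0|apply/eqP; rewrite pi0].
Qed.

(** The functions vanishing on a set of the ultrafilter form a maximal ideal: off
    such a set a function is inverted pointwise.  The equation of a root is solved
    pointwise as well.  *)
Lemma ultrapower (k : closedFieldType) (T : pointedType) (U : set_system T) : UltraFilter U ->
  exists (O : closedFieldType) (pi : {rmorphism (T -> k) -> O}),
    forall f, pi f = 0 <-> U [set t | f t = 0].
Proof.
move=> UU; pose S : {pred (T -> k)} := [pred f | `[< U [set t | f t = 0] >]].
have inS f : f \in S <-> U [set t | f t = 0] by rewrite inE; split=> [/asboolP|h] //; apply/asboolP.
have hS : idealr_closed S.
  split.
  - by apply/inS; apply: filterS filterT.
  - apply/negP=> /inS h; case: (@filter_not_empty _ U _); apply: filterS h => t /= /eqP.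
    by rewrite oner_eq0.
  - move=> a f g /inS hf /inS hg; apply/inS; apply: filterS (filterI hf hg) => t [/= ft gt].
    by rewrite -[LHS]/(a t * f t + g t) ft gt mulr0 addr0.
have [|Q [pi [pis pi0]]] := quotient_field hS.
  move=> f /negP fS; exists (fun t => (f t)^-1); apply/inS.
  have [/inS//|] := in_ultra_setVsetC [set t | f t = 0] UU.
  apply: filterS => t /= /eqP ft.
  by rewrite -[LHS]/((f t)^-1 * f t - 1) mulVf // subrr.
have ax : GRing.closed_field_axiom Q.
  move=> n P n0; have /choice[p hp] l := pis (P l).
  have /choice[x hx] t := @GRing.solve_monicpoly k n (fun l => p l t) n0.
  exists (pi x); rewrite -rmorphXn.
  have -> : x ^+ n = \sum_(l < n) p l * x ^+ l.
    have fX m t : (x ^+ m) t = x t ^+ m.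
      by elim: m => [|m IH] //; rewrite !exprS -IH.
    apply/funext => t; rewrite fX hx fct_sumE; apply: eq_bigr => l _.
    by rewrite -fX.
  by rewrite rmorph_sum; apply: eq_bigr => l _; rewrite rmorphM rmorphXn hp.
have [C [f [g [fg gf]]]] := close_field ax.
exists C, (f \o pi : {rmorphism _ -> _}) => h /=.
rewrite -inS -pi0; split=> [e|->]; last by rewrite rmorph0.
by rewrite -[LHS]fg e -(rmorph0 f) fg.
Qed.

(** * Algebraically closed fields with many independent elements *)

Section BigField.
Variables (k : closedFieldType) (I : Type).

Definition points : Type := I -> k.
HB.instance Definition _ := gen_eqMixin points.
HB.instance Definition _ := gen_choiceMixin points.
HB.instance Definition _ := isPointed.Build points (fun=> 0).

Implicit Types (f g : points -> k) (u v : points).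

Definition line u v (t : k) : points := fun i => u i + t * (v i - u i).

(** The functions that are polynomial on every affine line.  They include all
    polynomial functions in the coordinates, and form an integral domain without
    any bookkeeping of the finitely many variables that a polynomial involves.  *)
Definition linepoly f := forall u v, exists p : {poly k}, forall t, f (line u v t) = p.[t].

Lemma line0 u v : line u v 0 = u.
Proof. by apply/funext => i; rewrite /line mul0r addr0. Qed.

Lemma line1 u v : line u v 1 = v.
Proof. by apply/funext => i; rewrite /line mul1r addrC subrK. Qed.

Lemma linepoly_cst c : linepoly (fun=> c).
Proof. by move=> u v; exists c%:P => t; rewrite hornerC. Qed.

Lemma linepolyB f g : linepoly f -> linepoly g -> linepoly (f - g).
Proof.
move=> hf hg u v; have [p hp] := hf u v; have [q hq] := hg u v.
by exists (p - q) => t; rewrite -[LHS]/(f _ - g _) hp hq !hornerE.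
Qed.

Lemma linepolyM f g : linepoly f -> linepoly g -> linepoly (f * g).
Proof.
move=> hf hg u v; have [p hp] := hf u v; have [q hq] := hg u v.
by exists (p * q) => t; rewrite -[LHS]/(f _ * g _) hp hq !hornerE.
Qed.

Lemma linepoly_coord i : linepoly (fun u => u i).
Proof.
move=> u v; exists ((u i)%:P + (v i - u i) *: 'X) => t.
by rewrite !hornerE /line mulrC.
Qed.

Lemma linepolyX f n : linepoly f -> linepoly (f ^+ n).
Proof.
move=> hf; elim: n => [|n IH]; first exact: (linepoly_cst 1).
by rewrite exprS; apply: linepolyM.
Qed.

Lemma linepoly_sum n (F : 'I_n -> points -> k) :
  (forall l, linepoly (F l)) -> linepoly (\sum_(l < n) F l).
Proof.
move=> hF; apply: big_ind => [|f g hf hg|l _]; [exact: (linepoly_cst 0)| |exact: hF].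
rewrite -[g]opprK; apply: linepolyB => //; rewrite -[- g]sub0r.
by apply: linepolyB => //; exact: (linepoly_cst 0).
Qed.

(** On the line from u to v, both functions are nonzero polynomials in one variable,
    and k is infinite.  *)
Lemma linepoly_domain f g u v : linepoly f -> linepoly g -> f u != 0 -> g v != 0 ->
  exists w, f w * g w != 0.
Proof.
move=> hf hg fu gv; have [p hp] := hf u v; have [q hq] := hg u v.
have p0 : p != 0 by apply: contraNneq fu => p0; rewrite -(line0 u v) hp p0 horner0.
have q0 : q != 0 by apply: contraNneq gv => q0; rewrite -(line1 u v) hq q0 horner0.
have /closed_nonrootP[t ht] : p * q != 0 by rewrite mulf_neq0.
by exists (line u v t); rewrite hp hq -hornerM.
Qed.

(** Generated by the nonvanishing sets of nonzero functions; by [linepoly_domain]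
    these sets are stable under finite intersections.  *)
Definition line_filter : set_system points :=
  [set X | exists g, [/\ linepoly g, exists u, g u != 0 & [set u | g u != 0] `<=` X]].

Lemma line_filter_proper : ProperFilter line_filter.
Proof.
split; first by move=> [g [_ [u gu] /(_ u gu)]].
split.
- exists (fun=> 1); split=> //; first exact: linepoly_cst.
  by exists point; rewrite oner_neq0.
- move=> X Y [f [lf [u fu] fX]] [g [lg [v gv] gY]].
  exists (f * g); split; first exact: linepolyM.
    exact: linepoly_domain fu gv.
  by move=> w; rewrite /= -[(f * g) w]/(f w * g w) mulf_eq0 negb_or => /andP[/fX ? /gY].
- move=> X Y XY [g [lg gu gX]]; exists g; split=> //.
  exact: subset_trans XY.
Qed.

(** An equation for the class of the i-th coordinate over the other ones comes from
    functions f l that do not depend on this coordinate.  If some f l does not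
    vanish at u, then moving the i-th coordinate of u yields a nonzero polynomial in
    it, so the equation fails on a nonvanishing set, which belongs to the
    ultrafilter.  *)
Lemma big_field : exists (O : closedFieldType) (c : {rmorphism k -> O}) (x : I -> O),
  forall i, ~ acl [set x j | j in [set j | j <> i]] (x i).
Proof.
have [U [UU FU]] := ultraFilterLemma line_filter_proper.
have [O [pi pi0]] := ultrapower k UU.
have pi_neq0 g u : linepoly g -> g u != 0 -> pi g != 0.
  move=> lg gu; apply/eqP => /pi0 h1.
  have h2 : U [set u | g u != 0] by apply: FU; exists g; split=> //; exists u.
  case: (@filter_not_empty _ U _); apply: filterS (filterI h1 h2) => t [/= ->].
  by rewrite eqxx.
have [||c _] := @rmorphism_of k O (fun a => pi (fun=> a)).
- by move=> a b; rewrite -rmorphB.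
- by split=> [|a b]; rewrite -?rmorphM -?(rmorph1 pi).
exists O, c, (fun i => pi (fun u => u i)) => i.
pose R0 := [set y : O | exists f, [/\ linepoly f,
  forall u v, (forall j, j <> i -> u j = v j) -> f u = f v & pi f = y]].
have hR : subring_set R0.
  split=> [|_ _ [f [lf fi <-]] [g [lg gi <-]]|_ _ [f [lf fi <-]] [g [lg gi <-]]].
  - by exists (fun=> 1); split=> //; [exact: linepoly_cst|rewrite -(rmorph1 pi)].
  - exists (f - g); split=> [|u v uv|]; [exact: linepolyB| |by rewrite rmorphB].
    by rewrite -[LHS]/(f u - g u) (fi _ _ uv) (gi _ _ uv).
  - exists (f * g); split=> [|u v uv|]; [exact: linepolyM| |by rewrite rmorphM].
    by rewrite -[LHS]/(f u * g u) (fi _ _ uv) (gi _ _ uv).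
have sR : [set pi (fun u => u j) | j in [set j | j <> i]] `<=` R0.
  move=> _ [j ji <-]; exists (fun u => u j); split=> //; first exact: linepoly_coord.
  by move=> u v; apply.
move=> /(acl_clear hR sR)[P [P0 hP /rootP rP]].
have /choice[f hf] := hP.
pose xi : points -> k := fun u => u i.
pose h := \sum_(l < size P) f l * xi ^+ l.
have lh : linepoly h.
  apply: linepoly_sum => l; apply: linepolyM; first by case: (hf l).
  exact/linepolyX/linepoly_coord.
have ph : pi h = 0.
  rewrite -rP horner_coef rmorph_sum; apply: eq_bigr => l _.
  by rewrite rmorphM rmorphXn /=; case: (hf l) => _ _ ->.
have [u fu] : exists u, f (size P).-1 u != 0.
  apply: contrapT => /forallNP h0.
  have f0 : f (size P).-1 = 0 by apply/funext => u; apply/eqP; have /negP := h0 u; rewrite negbK.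
  have := hf (size P).-1; rewrite f0 rmorph0 => -[_ _ /esym/eqP].
  by rewrite -lead_coefE lead_coef_eq0 (negbTE P0).
pose r : {poly k} := \poly_(l < size P) f l u.
have /closed_nonrootP[t rt] : r != 0.
  apply: contraNneq fu => r0; have := congr1 (fun p : {poly k} => p`_(size P).-1) r0.
  by rewrite coef_poly coef0 ltn_predL size_poly_gt0 P0 => ->.
pose w : points := fun j => if pselect (j = i) then t else u j.
have wi : w i = t by rewrite /w; case: pselect.
have hw : h w = r.[t].
  rewrite /h fct_sumE horner_poly; apply: eq_bigr => l _.
  have fX m : (xi ^+ m) w = t ^+ m.
    by elim: m => [|m IH] //; rewrite !exprS -IH -wi.
  rewrite -[LHS]/(f l w * (xi ^+ l) w) fX; congr (_ * _).
  by case: (hf l) => _ + _; apply=> j ji; rewrite /w; case: pselect.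
by have := pi_neq0 h w lh; rewrite hw ph eqxx => /(_ rt).
Qed.

End BigField.

(** * Multiplicative dependence modulo torsion *)

Section Monomials.
Variable F : fieldType.
Implicit Types (C : set F) (a b : F).

Definition monomial C : set F :=
  [set x | exists s : seq F, (forall y, y \in s -> C y) /\ x = \prod_(y <- s) y].

Lemma monomial1 C : monomial C 1.
Proof. by exists [::]; rewrite big_nil. Qed.

Lemma monomial_gen C a : C a -> monomial C a.
Proof. by move=> Ca; exists [:: a]; rewrite big_seq1; split=> // y; rewrite inE => /eqP->. Qed.

Lemma monomialM C a b : monomial C a -> monomial C b -> monomial C (a * b).
Proof.
move=> [s [Cs ->]] [t [Ct ->]]; exists (s ++ t); rewrite big_cat; split=> // y.
by rewrite mem_cat => /orP[/Cs|/Ct].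
Qed.

Lemma monomialX C a n : monomial C a -> monomial C (a ^+ n).
Proof.
move=> Ca; elim: n => [|n IH]; first exact: monomial1.
by rewrite exprS; apply: monomialM.
Qed.

Lemma monomial_prod C (J : finType) (P : pred J) (u : J -> F) :
  (forall j, P j -> monomial C (u j)) -> monomial C (\prod_(j | P j) u j).
Proof. by move=> h; apply: big_ind => //; [exact: monomial1|move=> *; exact: monomialM]. Qed.

Lemma monomial_mono C C' : C `<=` C' -> monomial C `<=` monomial C'.
Proof. by move=> CC x [s [Cs ->]]; exists s; split=> // y /Cs /CC. Qed.

Lemma prod_count n (c : 'I_n -> F) (s : seq F) : injective c ->
  (forall y, y \in s -> exists i, c i = y) ->
  \prod_(y <- s) y = \prod_i c i ^+ count_mem (c i) s.
Proof.
move=> injc; elim: s => [|x s IH] hs.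
  by rewrite big_nil big1.
rewrite big_cons IH => [|y ys]; last by apply: hs; rewrite inE ys orbT.
have [i0 e0] : exists i, c i = x by apply: hs; rewrite mem_head.
under [RHS]eq_bigr do rewrite /= exprD; rewrite big_split /=; congr (_ * _).
rewrite (bigD1 i0) //= e0 eqxx expr1 big1 ?mulr1 // => i ii0.
by case: eqP => // e; case/eqP: ii0; apply: injc; rewrite e0.
Qed.

(** Only finitely many elements of C occur in finitely many products.  *)
Lemma monomial_family C (J : finType) (w : J -> F) : (forall j, monomial C (w j)) ->
  exists n (c : 'I_n -> F) (e : J -> 'I_n -> nat),
    [/\ injective c, forall i, C (c i) & forall j, w j = \prod_i c i ^+ e j i].
Proof.
move=> /choice[s hs]; pose S := undup (flatten [seq s j | j <- enum J]).
have uS : uniq S by exact: undup_uniq.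
have injc : injective (fun i : 'I_(size S) => S`_i).
  by move=> i i' /eqP; rewrite nth_uniq // => /eqP/val_inj.
exists (size S), (fun i => S`_i), (fun j i => count_mem S`_i (s j)); split=> // [i|j].
  have : S`_i \in S by apply: mem_nth.
  by rewrite mem_undup => /flatten_mapP[j _]; case: (hs j) => + _; apply.
case: (hs j) => Cs ->; apply: (prod_count injc) => y ys.
have yS : y \in S by rewrite mem_undup; apply/flatten_mapP; exists j; rewrite ?mem_enum.
by exists (Ordinal (etrans (index_mem y S) yS)); rewrite /= nth_index.
Qed.

(** The elements that are multiplicatively dependent on C: the units having a
    positive power in the group generated by C.  Quotients are avoided by writing
    a^N as v / u with u and v products of elements of C.  *)
Definition mclosure C : set F := [set a | a != 0 /\ exists N u v,
  [/\ (0 < N)%N, monomial C u, monomial C v, u != 0 & a ^+ N * u = v]].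

Lemma sub_mclosure C a : C a -> a != 0 -> mclosure C a.
Proof.
move=> Ca a0; split=> //; exists 1%N, 1, a; rewrite mulr1 oner_neq0.
by split=> //; [exact: monomial1|exact: monomial_gen].
Qed.

Lemma mclosure_mono C C' : C `<=` C' -> mclosure C `<=` mclosure C'.
Proof.
move=> /monomial_mono CC a [a0 [N [u [v [N0 Cu Cv u0 e]]]]]; split=> //.
by exists N, u, v; split=> //; apply: CC.
Qed.

Lemma mclosureM C a b : mclosure C a -> mclosure C b -> mclosure C (a * b).
Proof.
move=> [a0 [N [u [v [N0 Cu Cv u0 e]]]]] [b0 [M [w [t [M0 Cw Ct w0 e']]]]].
split; first by rewrite mulf_neq0.
exists (N * M)%N, (u ^+ M * w ^+ N), (v ^+ M * t ^+ N); rewrite muln_gt0 N0 M0; split=> //.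
- by apply: monomialM; exact: monomialX.
- by apply: monomialM; exact: monomialX.
- by rewrite mulf_neq0 ?expf_neq0.
- by rewrite -e -e' !exprMn -!exprM [(M * N)%N]mulnC mulrACA.
Qed.

Lemma mclosureV C a : mclosure C a -> mclosure C a^-1.
Proof.
move=> [a0 [N [u [v [N0 Cu Cv u0 e]]]]]; split; first by rewrite invr_neq0.
exists N, v, u; split=> //; first by rewrite -e mulf_neq0 ?expf_neq0.
by rewrite -e exprVn mulrA mulVf ?mul1r // expf_neq0.
Qed.

Lemma mclosure1 C : mclosure C 1.
Proof.
split; first exact: oner_neq0.
by exists 1%N, 1, 1; rewrite mul1r oner_neq0; split=> //; exact: monomial1.
Qed.

Lemma mclosureX C a n : mclosure C a -> mclosure C (a ^+ n).
Proof.
move=> Ca; elim: n => [|n IH]; first exact: mclosure1.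
by rewrite exprS; apply: mclosureM.
Qed.

Lemma mclosure_root C a n : (0 < n)%N -> mclosure C (a ^+ n) -> mclosure C a.
Proof.
move=> n0 [a0 [N [u [v [N0 Cu Cv u0 e]]]]]; split; first by move: a0; rewrite expf_eq0 n0.
by exists (n * N)%N, u, v; rewrite muln_gt0 n0 N0 exprM.
Qed.

(** A common exponent N and a common denominator: raise the equation of a j to the
    power NN / N j, and multiply it by the denominators of the other equations.  *)
Lemma mclosure_family C (J : finType) (a : J -> F) : (forall j, mclosure C (a j)) ->
  exists n (c : 'I_n -> F) (N : nat) (M : 'I_n -> nat) (e : J -> 'I_n -> nat),
    [/\ injective c, forall i, C (c i), (0 < N)%N &
        forall j, a j ^+ N * \prod_i c i ^+ M i = \prod_i c i ^+ e j i].
Proof.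
move=> ha; have /choice[N hN] j : exists N, exists u v,
  [/\ (0 < N)%N, monomial C u, monomial C v, u != 0 & a j ^+ N * u = v] by case: (ha j).
have /choice[u /choice[v huv]] := hN.
pose NN := (\prod_j N j)%N; pose q j := (NN %/ N j)%N.
have eq j : NN = (N j * q j)%N by rewrite /q mulnC divnK // /NN (bigD1 j) //= dvdn_mulr.
(* The index None stands for the common denominator. *)
pose w (o : option J) := if o is Some j then v j ^+ q j * \prod_(l | l != j) u l ^+ q l
                         else \prod_l u l ^+ q l.
have hw o : monomial C (w o).
  case: o => [j|]; [apply: monomialM|].
  - by apply: monomialX; case: (huv j).
  - by apply: monomial_prod => l _; apply: monomialX; case: (huv l).
  - by apply: monomial_prod => l _; apply: monomialX; case: (huv l).
have [n [c [e [injc Cc ec]]]] := monomial_family hw.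
exists n, c, NN, (e None), (fun j => e (Some j)); split=> //.
  by rewrite /NN prodn_gt0 // => j; case: (huv j).
move=> j; rewrite -!ec /= (bigD1 j) //= mulrA; congr (_ * _).
by rewrite {1}(eq j) exprM -exprMn; case: (huv j) => _ _ _ _ ->.
Qed.

(** Multiplicative independence of a set, as uniqueness of factorization into
    elements of C; comparing sequences up to permutation spares the exponents.  *)
Definition mindep C := ~ C 0 /\ forall s t : seq F,
  (forall y, y \in s -> C y) -> (forall y, y \in t -> C y) ->
  \prod_(y <- s) y = \prod_(y <- t) y -> perm_eq s t.

Lemma mindep_tuple C n (a : 'I_n -> F) : mindep C -> injective a ->
  (forall i, C (a i)) -> ~ mult_dependent a.
Proof.
move=> [_ hC] inja Ca [k [l [kl e]]].
pose S (k : {ffun 'I_n -> nat}) := flatten [seq nseq (k i) (a i) | i <- enum 'I_n].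
have CS k' y : y \in S k' -> C y by move=> /flatten_mapP[i _ /nseqP[-> _]].
have pS k' : \prod_(y <- S k') y = \prod_i a i ^+ k' i.
  by rewrite big_flatten big_map big_enum /=; apply: eq_bigr => i _; rewrite big_nseq -Monoid.iteropE.
have cS k' i : count_mem (a i) (S k') = k' i.
  rewrite count_flatten -map_comp sumnE big_map big_enum /= (bigD1 i) //= count_nseq /= eqxx mul1n.
  by rewrite big1 ?addn0 // => j ji; rewrite count_nseq /= (inj_eq inja) (negbTE ji).
have /permP pe : perm_eq (S k) (S l) by apply: hC (CS k) (CS l) _; rewrite !pS.
by case/eqP: kl; apply/ffunP => i; rewrite -!cS pe.
Qed.

(** The elements of s are added one at a time to C, unless independence would be
    lost; in that case the new element occurs with different multiplicities on the
    two sides of a relation, so a power of it is a quotient of products in C.  *)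
Lemma mclosure_basis (s : seq F) : 0 \notin s ->
  exists C, mindep C /\ forall a, a \in s -> mclosure C a.
Proof.
elim: s => [_|a s IH].
  exists set0; split=> //; split=> // s t Cs Ct _.
  have e (r : seq F) : (forall y, y \in r -> set0 y) -> r = [::].
    by case: r => // x r /(_ x (mem_head _ _)).
  by rewrite (e s Cs) (e t Ct).
rewrite inE negb_or => /andP[a0 s0]; have [C [iC hC]] := IH s0.
have [iCa|nCa] := pselect (mindep (C `|` [set a])).
  exists (C `|` [set a]); split=> // b; rewrite inE => /orP[/eqP->|/hC hb].
    by apply: sub_mclosure; [right|rewrite eq_sym].
  by apply: mclosure_mono hb => x; left.
exists C; split=> // b; rewrite inE => /orP[/eqP->{b}|]; last exact: hC.
have Ca0 : ~ (C `|` [set a]) 0 by move=> [|/eqP]; [case: iC|rewrite (negbTE a0)].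
have : ~ forall s t : seq F, (forall y, y \in s -> (C `|` [set a]) y) ->
    (forall y, y \in t -> (C `|` [set a]) y) ->
    \prod_(y <- s) y = \prod_(y <- t) y -> perm_eq s t.
  by move=> h; apply: nCa.
move=> /existsNP[s1 /existsNP[t1 /not_implyP[Cs /not_implyP[Ct /not_implyP[e npe]]]]].
pose u r := count_mem a r; pose cut r := [seq y <- r | y != a].
have pr r : \prod_(y <- r) y = a ^+ u r * \prod_(y <- cut r) y.
  elim: r => [|x r IHr]; first by rewrite /u /cut /= big_nil mulr1.
  rewrite big_cons IHr /u /cut /=; case: (eqVneq x a) => [->|xa] /=.
    by rewrite add1n exprS mulrA.
  by rewrite add0n big_cons mulrCA.
have Ccut r : (forall y, y \in r -> (C `|` [set a]) y) -> forall y, y \in cut r -> C y.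
  by move=> hr y; rewrite mem_filter => /andP[ya /hr[//|/= e']]; rewrite e' eqxx in ya.
have cut0 r : (forall y, y \in r -> (C `|` [set a]) y) -> \prod_(y <- cut r) y != 0.
  move=> /Ccut hr; rewrite prodf_seq_neq0; apply/allP => y /hr Cy /=.
  by apply: contraPneq Cy => ->; case: iC.
have permcut r : perm_eq r (nseq (u r) a ++ cut r).
  rewrite perm_sym /u -size_filter.
  have /all_pred1P <- := filter_all (pred1 a) r.
  by rewrite (perm_filterC (pred1 a) r).
have an0 : a != 0 by rewrite eq_sym.
have key s2 t2 : (forall y, y \in s2 -> (C `|` [set a]) y) ->
    (forall y, y \in t2 -> (C `|` [set a]) y) ->
    \prod_(y <- s2) y = \prod_(y <- t2) y -> (u t2 < u s2)%N -> mclosure C a.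
  move=> Cs2 Ct2 e2 lt; split=> //.
  exists (u s2 - u t2)%N, (\prod_(y <- cut s2) y), (\prod_(y <- cut t2) y).
  rewrite subn_gt0 lt cut0 //; split=> //.
  - by exists (cut s2); split=> //; apply: Ccut.
  - by exists (cut t2); split=> //; apply: Ccut.
  - apply: (mulfI (expf_neq0 (u t2) an0)); rewrite mulrA -exprD subnKC 1?ltnW //.
    by rewrite -!pr.
case: (ltngtP (u s1) (u t1)) => h; [exact: (key t1 s1)|exact: (key s1 t1)|].
case: npe; have : perm_eq (cut s1) (cut t1).
  case: iC => _; apply; try exact: Ccut.
  by apply: (mulfI (expf_neq0 (u s1) an0)); rewrite -pr e pr h.
move=> pc; apply: perm_trans (permcut s1) _; rewrite perm_sym.
by apply: perm_trans (permcut t1) _; rewrite -h perm_cat2l perm_sym.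
Qed.

End Monomials.

(** * Linear independence of the values of a character *)

Lemma aclW (L : fieldType) (A : set L) x : acl set0 x -> acl A x.
Proof. by apply: acl_mono => y []. Qed.

Lemma acl0 (L : fieldType) (A : set L) : acl A 0.
Proof. exact: (subring0 (subfieldW (acl_subfield A))). Qed.

Lemma acl_root_exp (L : fieldType) (A : set L) x n : (0 < n)%N -> acl A (x ^+ n) -> acl A x.
Proof.
move=> n0 hx; apply: (@acl_root _ A ('X^n - (x ^+ n)%:P)).
- by rewrite -size_poly_gt0 size_XnsubC.
- have hS := subfieldW (acl_subfield A).
  move=> i; rewrite coefB coefXn coefC; case: (hS) => h1 hB _; apply: hB.
    by case: eqP => // _; exact: acl0.
  by case: eqP => // _; exact: acl0.
- by rewrite rootE hornerD hornerN hornerXn hornerC subrr.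
Qed.

Definition torsion_equiv (F : fieldType) (a b : F) := exists2 N, (0 < N)%N & a ^+ N = b ^+ N.

(** Genericity is stated in the fraction field of K, into which K embeds.  *)
Lemma alg_independent_tofrac (K : fieldType) n (b : 'I_n -> K) :
  alg_independent (prime_subfield {fraction K}) (fun i => tofrac (b i)) <->
  forall i, ~ acl (others b i) (b i).
Proof.
rewrite alg_independentP; last exact: gen_subfield.
have e i : acl (prime_subfield {fraction K} `|` others (fun i => tofrac (b i)) i) (tofrac (b i))
   <-> acl (others b i) (b i).
  rewrite acl_genU set0U -(acl_morph (@tofrac K : {rmorphism K -> {fraction K}})) image_comp.
  by [].
by split=> h i /e; apply: h.
Qed.

Section Character.
Variables (F : fieldType) (K : closedFieldType) (chi : F -> K).
Hypothesis chi_char : is_character chi.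

Lemma chiM a b : chi (a * b) = chi a * chi b. Proof. by case: chi_char => h _ _; apply: h. Qed.
Lemma chi0 : chi 0 = 0. Proof. by case: chi_char. Qed.
Lemma chi1 : chi 1 = 1. Proof. by case: chi_char. Qed.
Lemma chiX a n : chi (a ^+ n) = chi a ^+ n.
Proof. by elim: n => [|n IH]; rewrite ?expr0 ?chi1 // !exprS chiM IH. Qed.
Lemma chi_prod (J : Type) (r : seq J) (P : pred J) (a : J -> F) :
  chi (\prod_(j <- r | P j) a j) = \prod_(j <- r | P j) chi (a j).
Proof. by elim/big_rec2: _ => [|i y1 y2 _ <-]; rewrite ?chi1 ?chiM. Qed.
Lemma chi_neq0 a : a != 0 -> chi a != 0.
Proof.
move=> a0; apply/eqP => h; have := chiM a a^-1.
by rewrite divff // h mul0r chi1 => /eqP; rewrite oner_eq0.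
Qed.

(** The elements a j are, up to a root of unity and modulo the common factor with
    exponents M, monomials in N-th roots of the c i.  Hence chi (a j) is, up to the
    same kind of factor, a root of unity xi j times a monomial in N-th roots y of the
    chi (c i).  These are again algebraically independent, even over the algebraic
    numbers, and elements with the same monomial are equivalent modulo torsion, so
    the sum is the value at y of a polynomial with coefficients z j * xi j.  *)
Lemma linear_independence_of_radicals n (c : 'I_n -> F) (J : finType) (a : J -> F) (z : J -> K)
    (N : nat) (M : 'I_n -> nat) (e : J -> 'I_n -> nat) :
  (forall i, ~ acl (others (chi \o c) i) (chi (c i))) ->
  (0 < N)%N -> (forall j, a j != 0) ->
  (forall j, a j ^+ N * \prod_i c i ^+ M i = \prod_i c i ^+ e j i) ->
  (forall j, acl set0 (z j)) ->
  (forall j l, j != l -> z j != 0 -> z l != 0 -> ~ torsion_equiv (a j) (a l)) ->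
  \sum_j z j * chi (a j) = 0 -> forall j, z j = 0.
Proof.
move=> indc N0 a0 ea hz hdist hsum.
have c0 i : c i != 0.
  by apply/eqP => e0; apply: (indc i); rewrite e0 chi0; exact: acl0.
have /choice[y hy] i : exists y : K, y ^+ N = chi (c i).
  have [|y /rootP] := closed_rootP ('X^N - (chi (c i))%:P : {poly K}) _.
    by rewrite size_XnsubC // -lt0n.
  by rewrite hornerD hornerN hornerXn hornerC => /subr0_eq; exists y.
have y0 i : y i != 0.
  by have := chi_neq0 (c0 i); rewrite -hy expf_eq0 N0.
pose mon (b : 'I_n -> K) (m : 'I_n -> nat) := \prod_i b i ^+ m i.
have mon_neq0 m : mon y m != 0 by apply/prodf_neq0 => i _; rewrite expf_neq0.
have indy : alg_independent (acl set0) y.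
  apply/alg_independentP; first exact: acl_subfield.
  move=> i hi; apply: (indc i); rewrite -hy.
  apply: (subringX _ (subfieldW (acl_subfield _))).
  apply: acl_min hi => x [/aclW //|[l li <-]].
  apply: (acl_root_exp N0); rewrite hy; apply: sub_acl.
  by exists l.
pose xi j := chi (a j) * mon y M / mon y (e j).
have xiE j : chi (a j) * mon y M = xi j * mon y (e j) by rewrite divfK.
have monN m : mon y m ^+ N = chi (\prod_i c i ^+ m i).
  rewrite chi_prod -prodrXl; apply: eq_bigr => i _.
  by rewrite chiX -hy -!exprM mulnC.
have xiN j : xi j ^+ N = 1.
  rewrite /xi expr_div_n exprMn !monN -chiX -chiM ea divff //.
  by rewrite -monN expf_neq0.
have xi_acl j : acl set0 (xi j).
  by apply: (acl_root_exp N0); rewrite xiN; case: (acl_subfield (@set0 K)).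
have xi_neq0 j : xi j != 0 by apply: contra_eqN (xiN j) => /eqP->; rewrite expr0n eqn0Ngt N0 eq_sym oner_eq0.
have einj j l : j != l -> z j != 0 -> z l != 0 -> e j <> e l.
  move=> jl zj zl ejl; apply: (hdist j l) => //; exists N => //.
  have m0 : \prod_i c i ^+ M i != 0 by apply/prodf_neq0 => i _; rewrite expf_neq0.
  by apply: (mulIf m0); rewrite !ea ejl.
pose mn j : 'X_{1..n} := [multinom e j i | i < n].
pose P : {mpoly K[n]} := \sum_j (z j * xi j) *: 'X_[mn j].
have PE m : P@_m = \sum_j z j * xi j * (mn j == m)%:R.
  by rewrite /P raddf_sum; apply: eq_bigr => j _; rewrite /= mcoeffZ mcoeffX.
have sS := subfieldW (acl_subfield (@set0 K)).
have P0 : P = 0.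
  apply: indy => [m|].
    rewrite PE; apply: (subring_sum _ sS) => j _.
    apply: (subringM sS); first exact: (subringM sS).
    by case: (_ == _); [case: sS|exact: acl0].
  rewrite /P raddf_sum /=.
  transitivity (\sum_j z j * chi (a j) * mon y M); last by rewrite -mulr_suml hsum mul0r.
  apply: eq_bigr => j _; rewrite mevalZ mevalX -[RHS]mulrA xiE -mulrA; congr (_ * (_ * _)).
  by apply: eq_bigr => i _; rewrite mnmE.
move=> j; apply/eqP; apply: contraT => zj.
have := PE (mn j); rewrite P0 mcoeff0 (bigD1 j) //= eqxx mulr1 big1 ?addr0.
  by move/esym/eqP; rewrite mulf_eq0 (negbTE zj) (negbTE (xi_neq0 j)).
move=> l lj; have [->|zl] := eqVneq (z l) 0; first by rewrite !mul0r.
case: eqP => [h|]; last by rewrite mulr0.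
case: (einj l j lj zl zj); apply/funext => i.
by have := congr1 (fun m : 'X_{1..n} => m i) h; rewrite !mnmE.
Qed.

Lemma mult_independent_neq0 n (a : 'I_n -> F) i : ~ mult_dependent a -> a i != 0.
Proof.
move=> ha; apply/eqP => ai; apply: ha.
exists [ffun j => (j == i) : nat], [ffun j => ((j == i) * 2)%N]; split.
  by apply/eqP => /ffunP/(_ i); rewrite !ffunE eqxx.
by rewrite (bigD1 i) // [RHS](bigD1 i) //= !ffunE eqxx ai expr1 mul0r mul1n expr0n mul0r.
Qed.

(** For a multiplicatively independent tuple, distinct monomials are distinct modulo
    torsion, so an algebraic relation between the values is a linear relation of the
    kind excluded by [linear_independence_of_radicals].  *)
Lemma generic_of_basis (C : set F) : injective chi ->
  (forall n (c : 'I_n -> F), injective c -> (forall i, C (c i)) ->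
    forall i, ~ acl (others (chi \o c) i) (chi (c i))) ->
  (forall a, a != 0 -> mclosure C a) -> generic chi.
Proof.
move=> inj_chi indC spanC; split=> // n a n0 ha.
apply/alg_independent_tofrac.
suff /(alg_independentP _ (gen_subfield set0)) h : alg_independent (prime_subfield K) (chi \o a).
  by move=> i; have := h i; rewrite acl_genU set0U.
move=> P kP Pa.
pose J := seq_sub (msupp P); pose m (j : J) : 'X_{1..n} := ssval j.
pose b (j : J) := \prod_i a i ^+ m j i.
have b0 j : b j != 0.
  by apply/prodf_neq0 => i _; rewrite expf_neq0 // mult_independent_neq0.
have [s [c [N [M [e [injc Cc N0 he]]]]]] := mclosure_family (fun j => spanC _ (b0 j)).
have z0 : forall j : J, P@_(m j) = 0.
  apply: (linear_independence_of_radicals (indC _ _ injc Cc) N0 b0 he).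
  - by move=> j; rewrite -acl_gen; apply/sub_acl/kP.
  - move=> j l jl _ _ [N' N'0 eN]; case/eqP: jl.
    apply: val_inj; apply/mnmP => i /=; apply: contrapT => /eqP ne.
    apply: ha; exists [ffun i => (m j i * N')%N], [ffun i => (m l i * N')%N]; split.
      by apply/eqP => /ffunP/(_ i); rewrite !ffunE => /eqP; rewrite eqn_pmul2r // (negbTE ne).
    under eq_bigr do rewrite ffunE exprM; under [RHS]eq_bigr do rewrite ffunE exprM.
    by rewrite !prodrXl.
  - rewrite -[RHS]Pa mevalE.
    transitivity (\sum_(mm <- [seq m j | j <- enum {: J}]) P@_mm * \prod_i chi (a i) ^+ mm i).
      rewrite big_map big_enum /=; apply: eq_bigr => j _; congr (_ * _).
      by rewrite chi_prod; apply: eq_bigr => i _; rewrite chiX.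
    apply: perm_big; apply: uniq_perm; rewrite ?msupp_uniq //.
      by rewrite (map_inj_uniq val_inj) enum_uniq.
    move=> x; apply/mapP/idP => [[j _ ->]|xs]; first exact: ssvalP.
    by exists (SeqSub xs); rewrite ?mem_enum.
apply/mpolyP => mm; rewrite mcoeff0; have [h|h] := boolP (mm \in msupp P).
  exact: (z0 (SeqSub h)).
exact: memN_msupp_eq0.
Qed.

Lemma generic_acl n (a : 'I_n -> F) i : generic chi -> ~ mult_dependent a ->
  ~ acl (others (chi \o a) i) (chi (a i)).
Proof.
move=> [_ gen_chi] ha; have n0 : (0 < n)%N by case: n a i ha => // a [].
by have /alg_independent_tofrac := gen_chi n a n0 ha; apply.
Qed.

(** [mclosure_basis] provides an independent family on which all the a j depend, to
    which the genericity of chi applies.  *)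
Lemma linear_independence (J : finType) (a : J -> F) (z : J -> K) : generic chi ->
  (forall j, a j != 0) -> (forall j, acl set0 (z j)) ->
  (forall j l, j != l -> z j != 0 -> z l != 0 -> ~ torsion_equiv (a j) (a l)) ->
  \sum_j z j * chi (a j) = 0 -> forall j, z j = 0.
Proof.
move=> gchi a0; have [|C [iC hC]] := @mclosure_basis F [seq a j | j <- enum J].
  by apply/negP => /mapP[j _ /eqP]; rewrite eq_sym (negbTE (a0 j)).
have aC j : mclosure C (a j) by apply: hC; apply: map_f; rewrite mem_enum.
have [s [c [N [M [e [injc Cc N0 he]]]]]] := mclosure_family aC.
apply: linear_independence_of_radicals N0 a0 he => i.
by apply: generic_acl => //; exact: mindep_tuple Cc.
Qed.

End Character.

(** * Conjugacy of primitive roots of unity *)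

Lemma char0_intr_eq0 (K : fieldType) (m : int) : has_char K 0 -> (m%:~R == 0 :> K) = (m == 0).
Proof.
move=> hK; have hn n : (n%:R == 0 :> K) = (n == 0%N).
  apply/eqP/eqP => [|->] // h; apply/eqP; rewrite -leqn0 leqNgt; apply/negP => n0.
  have [p] := natf0_pchar n0 (introT eqP h).
  by rewrite hK.
case: m => m; first by rewrite -pmulrn hn.
by rewrite NegzE mulrNz oppr_eq0 -pmulrn hn.
Qed.

(** X^n - 1 is the product of the Phi_d with d dividing n, and a root of Phi_d has
    order dividing d.  *)
Lemma prim_root_Cyclotomic (K : fieldType) n (z : K) : has_char K 0 ->
  n.-primitive_root z -> root (map_poly intr 'Phi_n) z.
Proof.
move=> hK pz; have n0 := prim_order_gt0 pz.
have dvd_root d : (0 < d)%N -> root (map_poly intr 'Phi_d) z -> z ^+ d = 1.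
  move=> d0 rd; apply/eqP; rewrite -subr_eq0.
  have : root (map_poly intr ('X^d - 1)) z.
    rewrite -prod_Cyclotomic // (big_rem d) -?dvdn_divisors //= rmorphM rootM.
    by rewrite rd.
  by rewrite rmorphB rmorph1 /= map_polyXn rootE !hornerE.
have : root (map_poly intr ('X^n - 1)) z.
  by rewrite rmorphB rmorph1 /= map_polyXn rootE !hornerE (prim_expr_order pz) subrr.
rewrite -prod_Cyclotomic // rmorph_prod /= => /rootP /eqP.
rewrite horner_prod => /eqP/eqP; rewrite prodf_seq_eq0 => /hasP[d].
rewrite -dvdn_divisors //= => dn rd.
have d0 : (0 < d)%N by apply: dvdn_gt0 dn.
have : (n %| d)%N by rewrite (prim_order_dvd pz); apply/eqP; apply: dvd_root => //; exact: rd.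
by move=> nd; have /eqP -> : n == d by rewrite eqn_dvd nd dn.
Qed.

Lemma root_dvdp_int (K : fieldType) (P Q : {poly int}) (z : K) : has_char K 0 ->
  P %| Q -> root (map_poly intr P) z -> root (map_poly intr Q) z.
Proof.
move=> hK /Pdiv.Idomain.dvdpP[[k q] /= k0 e] rP.
have := congr1 (fun q => (map_poly (intr : int -> K) q).[z]) e.
rewrite /= map_polyZ /= rmorphM hornerZ hornerM (rootP rP) mulr0 => /eqP.
by rewrite mulf_eq0 char0_intr_eq0 // (negbTE k0).
Qed.

Lemma algC_char0 : has_char algC 0.
Proof. exact: Num.Theory.pchar_num. Qed.

(** If Phi_n and P are coprime, a Bezout relation over the integers contradicts the
    common root z.  Otherwise they share a root among the algebraic numbers; it is a
    primitive n-th root of unity, whose minimal polynomial Phi_n therefore divides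
    P.  *)
Lemma prim_root_conjugate (K K' : fieldType) n (z : K) (z' : K') (P : {poly int}) :
  has_char K 0 -> has_char K' 0 -> n.-primitive_root z -> n.-primitive_root z' ->
  root (map_poly intr P) z -> root (map_poly intr P) z'.
Proof.
move=> hK hK' pz pz' rP; have n0 := prim_order_gt0 pz.
have rz := prim_root_Cyclotomic hK pz; have rz' := prim_root_Cyclotomic hK' pz'.
have [cop|ncop] := boolP (coprimep 'Phi_n P).
  have /Pdiv.Idomain.Bezout_coprimepP[[u v]] := cop.
  rewrite -size_poly_eq1 => /size_poly1P[c c0 e].
  have := congr1 (fun q => (map_poly (intr : int -> K) q).[z]) e.
  rewrite /= rmorphD !rmorphM /= hornerD !hornerM (rootP rz) (rootP rP) !mulr0 addr0.
  by rewrite map_polyC hornerC => /esym/eqP; rewrite char0_intr_eq0 // (negbTE c0).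
suff dvd : 'Phi_n %| P by exact: root_dvdp_int dvd rz'.
pose g := gcdp 'Phi_n P.
have [w rw] : exists w, root (map_poly (intr : int -> algC) g) w.
  apply/closed_rootP; rewrite size_map_inj_poly //; exact: intr_inj.
have rwPhi : root (map_poly (intr : int -> algC) 'Phi_n) w.
  by apply: root_dvdp_int rw; [exact: algC_char0|exact: dvdp_gcdl].
have rwP : root (map_poly (intr : int -> algC) P) w.
  by apply: root_dvdp_int rw; [exact: algC_char0|exact: dvdp_gcdr].
have [z0 pz0] := C_prim_root_exists n0.
have pw : n.-primitive_root w.
  move: rwPhi; rewrite (Cintr_Cyclotomic pz0).
  by rewrite root_cyclotomic.
have [pf [Dpf mon_pf] dv_pf] := minCpolyP w.
rewrite (minCpoly_cyclotomic pw) -(Cintr_Cyclotomic pw) in Dpf.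
have ratz (q : {poly int}) : map_poly (intr : int -> algC) q = map_poly ratr (map_poly (intr : int -> rat) q).
  by rewrite -map_poly_comp; apply: eq_map_poly => b; rewrite /= rmorph_int.
have epf : pf = map_poly intr 'Phi_n.
  apply: (map_inj_poly (fmorph_inj ratr) (rmorph0 _)); exact: etrans (esym Dpf) (ratz _).
rewrite -dvdp_rat_int -epf -dv_pf -ratz.
exact: rwP.
Qed.

(** * Linear relations between the values of a character *)

Lemma subring_intr (L : fieldType) (S : set L) (m : int) : subring_set S -> S m%:~R.
Proof.
move=> hS; have hn n : S n%:R.
  elim: n => [|n IH]; first exact: subring0.
  by rewrite -addn1 natrD; apply: subringD => //; case: hS.
by case: m => n; [rewrite -pmulrn|rewrite NegzE mulrNz -pmulrn; apply: subringN].
Qed.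

Lemma closed_prim_root (F : closedFieldType) n : (n%:R != 0 :> F) -> exists w : F, n.-primitive_root w.
Proof.
move=> nF; have n0 : (0 < n)%N by rewrite lt0n; apply: contraNneq nF => ->.
have [r er] := closed_field_poly_normal ('X^n - 1 : {poly F}).
rewrite lead_coefXnsubC // scale1r in er.
have sr : size r = n by have := size_prod_XsubC r id; rewrite -er size_XnsubC // => -[].
have ur : uniq r by rewrite -separable_prod_XsubC -er separable_Xn_sub_1.
have /hasP[w _ pw] : has n.-primitive_root r.
  apply: has_prim_root => //; rewrite ?sr //; apply/allP => x.
  by rewrite -root_prod_XsubC -er unity_rootE rootE hornerD hornerN hornerXn hornerC subr_eq0.
by exists w.
Qed.

Lemma pchar_exp_inj (F : fieldType) p (x : F) : p \in [pchar F] -> x ^+ p = 1 -> x = 1.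
Proof.
move=> hp xp; apply: (fmorph_inj (pFrobenius_aut hp)).
by rewrite rmorph1 /= pFrobenius_autE.
Qed.

(** In characteristic p, raising to the power p is injective, so the factors p of N
    can be dropped.  *)
Lemma separable_exponent (F : fieldType) N (J : Type) (a : J -> F) : (0 < N)%N ->
  (forall j, a j ^+ N = 1) -> exists2 M, M%:R != 0 :> F & forall j, a j ^+ M = 1.
Proof.
elim/ltn_ind: N => N IH N0 aN.
have [e|ne] := eqVneq (N%:R : F) 0; last by exists N.
have [p hp] := natf0_pchar N0 (introT eqP e).
have pp := pcharf_prime hp; have p1 := prime_gt1 pp.
have /dvdnP[M eM] : (p %| N)%N by rewrite (dvdn_pcharf hp) e.
have M0 : (0 < M)%N by move: N0; rewrite eM muln_gt0 => /andP[].
apply: (IH M) => //; first by rewrite eM ltn_Pmulr.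
by move=> j; apply: (pchar_exp_inj hp); rewrite -exprM -eM.
Qed.

Lemma chi_prim_root (F : fieldType) (K : closedFieldType) (chi : F -> K) n w :
  is_character chi -> injective chi ->
  n.-primitive_root w -> n.-primitive_root (chi w).
Proof.
move=> hchi ichi pw; have n0 := prim_order_gt0 pw.
have wn : chi w ^+ n = 1 by rewrite -(chiX hchi) (prim_expr_order pw) (chi1 hchi).
have [m pm mn] := prim_order_exists n0 wn.
have nm : (n %| m)%N.
  rewrite (prim_order_dvd pw); apply/eqP/ichi.
  by rewrite (chiX hchi) (prim_expr_order pm) (chi1 hchi).
by have /eqP <- : m == n by rewrite eqn_dvd nm mn.
Qed.

Section Relations.
Variables (F : closedFieldType) (K K' : closedFieldType) (chi : F -> K) (chi' : F -> K').
Hypotheses (hchi : is_character chi) (hchi' : is_character chi').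
Hypotheses (K0 : has_char K 0) (K'0 : has_char K' 0).

(** All the a j are powers of one primitive root w, so the relation says that a
    polynomial with integer coefficients vanishes at chi w; chi' w is a conjugate of
    chi w since both have the order of w.  *)
Lemma torsion_relation (J : finType) (a : J -> F) (c : J -> int) N :
  injective chi -> injective chi' -> (0 < N)%N -> (forall j, a j ^+ N = 1) ->
  \sum_j (c j)%:~R * chi (a j) = 0 -> \sum_j (c j)%:~R * chi' (a j) = 0.
Proof.
move=> ichi ichi' N0 aN; have [M MF aM] := separable_exponent N0 aN.
have [w pw] := closed_prim_root MF.
have /choice[e he] j : exists e, a j = w ^+ e by have [e ->] := prim_rootP pw (aM j); exists e.
pose P : {poly int} := \sum_j c j *: 'X^(e j).
have PE (E : closedFieldType) (psi : F -> E) : is_character psi ->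
    (map_poly intr P).[psi w] = \sum_j (c j)%:~R * psi (a j).
  move=> hpsi; rewrite rmorph_sum horner_sum; apply: eq_bigr => j _.
  by rewrite /= map_polyZ /= map_polyXn hornerZ hornerXn he (chiX hpsi).
rewrite -!PE // => /rootP h; apply/rootP.
exact: prim_root_conjugate (chi_prim_root hchi ichi pw) (chi_prim_root hchi' ichi' pw) h.
Qed.

Lemma torsion_equiv_sym (a b : F) : torsion_equiv a b -> torsion_equiv b a.
Proof. by move=> [N N0 e]; exists N. Qed.

Lemma torsion_equiv_trans (a b c : F) : torsion_equiv a b -> torsion_equiv b c -> torsion_equiv a c.
Proof.
move=> [N N0 e] [M M0 e']; exists (N * M)%N; first by rewrite muln_gt0 N0.
by rewrite exprM e -exprM mulnC exprM e' -exprM mulnC.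
Qed.

(** Factoring out a representative of each class modulo torsion splits the sum into
    blocks z l; by linear independence all the blocks vanish, and each of them is a
    relation between values at roots of unity.  *)
Lemma character_relation_units (J : finType) (a : J -> F) (c : J -> int) :
  generic chi -> generic chi' -> (forall j, a j != 0) ->
  \sum_j (c j)%:~R * chi (a j) = 0 -> \sum_j (c j)%:~R * chi' (a j) = 0.
Proof.
move=> gchi gchi' a0 hsum.
(* The choice made by pick depends on the class only, because it is made
   extensionally; hence rep is constant on classes. *)
pose eqv j l := `[< torsion_equiv (a j) (a l) >].
have eqv_refl j : eqv j j by apply/asboolP; exists 1%N.
have eqv_sym j l : eqv j l = eqv l j by apply/asboolP/asboolP; exact: torsion_equiv_sym.
have eqv_trans j l m : eqv j l -> eqv l m -> eqv j m.
  by move=> /asboolP h /asboolP h'; apply/asboolP; exact: torsion_equiv_trans h h'.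
pose rep j := odflt j [pick l | eqv l j].
have rep_eqv j : eqv (rep j) j.
  by rewrite /rep; case: pickP => [//|/(_ j)]; rewrite eqv_refl.
have eqv_rep j l : eqv j l -> rep j = rep l.
  move=> jl; rewrite /rep; have -> : [pick l0 | eqv l0 j] = [pick l0 | eqv l0 l].
    apply: eq_pick => m; apply/idP/idP => h; first exact: eqv_trans h jl.
    by apply: eqv_trans h _; rewrite eqv_sym.
  by case: pickP => [//|/(_ l)]; rewrite eqv_refl.
pose z (E : closedFieldType) (psi : F -> E) l : E :=
  \sum_(j | rep j == l) (c j)%:~R * psi (a j / a l).
have zE (E : closedFieldType) (psi : F -> E) : is_character psi ->
    \sum_l z E psi l * psi (a l) = \sum_j (c j)%:~R * psi (a j).
  move=> hpsi; rewrite [RHS](partition_big rep xpredT) //=; apply: eq_bigr => l _.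
  rewrite mulr_suml; apply: eq_bigr => j _.
  by rewrite -mulrA -(chiM hpsi) divfK.
have z0 : forall l, z K chi l = 0.
  apply: (linear_independence hchi gchi a0).
  - move=> l; have sS := subfieldW (acl_subfield (@set0 K)).
    apply: (subring_sum _ sS) => j /eqP jl; apply: (subringM sS).
      exact: subring_intr.
    have /asboolP[N N0 e] := rep_eqv j; rewrite jl in e.
    apply: (acl_root_exp N0); rewrite -(chiX hchi) expr_div_n -e divff ?expf_neq0 //.
    by rewrite (chi1 hchi); case: sS.
  - have zn0 l : z K chi l != 0 -> exists j, rep j = l.
      move=> h; apply: contrapT => /forallNP nj; case/eqP: h.
      by rewrite /z big_pred0 // => j; apply/eqP/nj.
    move=> j l jl /zn0[j' ej] /zn0[l' el] /asboolP h; case/eqP: jl.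
    rewrite -ej -el; apply: eqv_rep.
    apply: eqv_trans (eqv_trans _ _ _ _ h) _; first by rewrite eqv_sym -ej.
    by rewrite -el.
  - by rewrite zE.
have z0' l : z K' chi' l = 0.
  (* Outside the block of l, the indices get coefficient 0 and element 1. *)
  pose b j := if rep j == l then a j / a l else 1.
  pose d j := if rep j == l then c j else 0.
  have zb (E : closedFieldType) (psi : F -> E) :
      z E psi l = \sum_j (d j)%:~R * psi (b j).
    rewrite /z big_mkcond /=; apply: eq_bigr => j _; rewrite /b /d; case: eqP => // _.
    by rewrite mul0r.
  have /choice[N hN] j : exists N, (0 < N)%N /\ b j ^+ N = 1.
    rewrite /b; case: eqP => [jl|_]; last by exists 1%N; rewrite expr1.
    have /asboolP[N N0 e] := rep_eqv j; rewrite jl in e; exists N; split=> //.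
    by rewrite expr_div_n -e divff ?expf_neq0.
  rewrite zb; apply: (@torsion_relation _ _ _ (\prod_j N j)%N).
  - by case: gchi.
  - by case: gchi'.
  - by rewrite prodn_gt0 // => j; case: (hN j).
  - by move=> j; rewrite (bigD1 j) //= exprM; case: (hN j) => _ ->; rewrite expr1n.
  - by rewrite -zb.
by rewrite -zE // big1 // => l _; rewrite z0' mul0r.
Qed.

Lemma character_relation (J : finType) (a : J -> F) (c : J -> int) :
  generic chi -> generic chi' ->
  \sum_j (c j)%:~R * chi (a j) = 0 -> \sum_j (c j)%:~R * chi' (a j) = 0.
Proof.
move=> gchi gchi'.
pose b j := if a j == 0 then 1 else a j.
pose d j := if a j == 0 then 0 else c j.
have e (E : closedFieldType) (psi : F -> E) : is_character psi ->
    \sum_j (c j)%:~R * psi (a j) = \sum_j (d j)%:~R * psi (b j).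
  move=> hpsi; apply: eq_bigr => j _; rewrite /b /d; case: eqP => // ->.
  by rewrite (chi0 hpsi) mul0r mulr0.
rewrite !e //; apply: character_relation_units => // j.
by rewrite /b; case: (eqVneq (a j) 0) => // _; rewrite oner_neq0.
Qed.

End Relations.

(** * Construction of a generic character *)

Section UnitIso.
Variables F K : fieldType.
Implicit Types G : set (F * K).

(** The graph of an isomorphism between subgroups of the unit groups.  *)
Definition unit_iso G :=
  [/\ G (1, 1),
      forall a a' b b', G (a, a') -> G (b, b') -> G (a * b, a' * b'),
      forall a a', G (a, a') -> G (a^-1, a'^-1),
      forall a a', G (a, a') -> a != 0 /\ a' != 0
    & forall a a', G (a, a') -> (a = 1 <-> a' = 1)].

Lemma unit_isoX G a b n : unit_iso G -> G (a, b) -> G (a ^+ n, b ^+ n).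
Proof. by move=> [G1 GM _ _ _] Gab; elim: n => [|n IH] //; rewrite !exprS; apply: GM. Qed.

Lemma unit_iso_inj G a b a' b' : unit_iso G -> G (a, a') -> G (b, b') -> a = b <-> a' = b'.
Proof.
move=> [_ GM GV Gn Gi] Ga Gb; have [b0 b'0] := Gn _ _ Gb.
have := Gi _ _ (GM _ _ _ _ Ga (GV _ _ Gb)) => h.
have e (L : fieldType) (x y : L) : y != 0 -> (x / y = 1 <-> x = y).
  move=> y0; split=> [/(congr1 (fun z => z * y))|->]; first by rewrite divfK // mul1r.
  by rewrite divff.
by rewrite -(e _ a b) // h e.
Qed.

(** The relation generated by G and (a, b); the quotients of powers account for the
    exponents in the integers.  *)
Definition adjoin_unit G a b : set (F * K) :=
  [set p | exists h h' i j, G (h, h') /\ p = (h * a ^+ i / a ^+ j, h' * b ^+ i / b ^+ j)].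

(** The condition under which an isomorphism of unit groups extends by sending a to
    b.  *)
Definition matching G a b :=
  forall h h' i, G (h, h') -> (h * a ^+ i = 1 <-> h' * b ^+ i = 1).

Lemma sub_adjoin_unit G a b : G `<=` adjoin_unit G a b.
Proof. by move=> [h h'] Gh; exists h, h', 0%N, 0%N; rewrite !expr0 !mulr1 !divr1. Qed.

Lemma adjoin_unit_gen G a b : G (1, 1) -> adjoin_unit G a b (a, b).
Proof. by move=> G1; exists 1, 1, 1%N, 0%N; rewrite !expr0 !mul1r !divr1. Qed.

Lemma adjoin_unit_iso G a b : unit_iso G -> a != 0 -> b != 0 -> matching G a b ->
  unit_iso (adjoin_unit G a b).
Proof.
move=> hG a0 b0 hab; case: (hG) => G1 GM GV Gn Gi; split.
- exact: sub_adjoin_unit.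
- move=> _ _ _ _ [h [h' [i [j [Gh [-> ->]]]]]] [g [g' [k [l [Gg [-> ->]]]]]].
  exists (h * g), (h' * g'), (i + k)%N, (j + l)%N; split; first exact: GM.
  by rewrite !exprD; congr (_, _); field; rewrite ?expf_neq0.
- move=> _ _ [h [h' [i [j [Gh [-> ->]]]]]].
  have [h0 h'0] := Gn _ _ Gh.
  exists h^-1, h'^-1, j, i; split; first exact: GV.
  by congr (_, _); field; rewrite ?h0 ?h'0 ?expf_neq0.
- move=> _ _ [h [h' [i [j [Gh [-> ->]]]]]]; have [h0 h'0] := Gn _ _ Gh.
  by rewrite !mulf_neq0 ?invr_neq0 ?expf_neq0.
- move=> _ _ [h [h' [i [j [Gh [-> ->]]]]]]; have [h0 h'0] := Gn _ _ Gh.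
  (* For j > i, pass to the inverse in order to have a nonnegative exponent. *)
  have e (L : fieldType) (x y : L) : x != 0 -> y != 0 ->
     x * y ^+ i / y ^+ j = 1 <->
     (if (j <= i)%N then x * y ^+ (i - j) = 1 else x^-1 * y ^+ (j - i) = 1).
    move=> x0 y0; have [ji|ij] := leqP j i.
      by rewrite -{1}(subnK ji) exprD mulrA mulfK // expf_neq0.
    have -> : x * y ^+ i / y ^+ j = (x^-1 * y ^+ (j - i))^-1.
      rewrite -{1}(subnK (ltnW ij)) exprD; field.
      by rewrite x0 !expf_neq0.
    by split=> [h1|->]; rewrite ?invr1 // -[LHS]invrK h1 invr1.
  rewrite (e _ h a) // (e _ h' b) //; case: leqP => _; apply: hab => //.
  exact: GV.
Qed.

End UnitIso.

(** Bezout's identity for the exponents i and l.  *)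
Lemma coprime_exp_mem (F : fieldType) (D : set F) a i l : (forall x y, D x -> D y -> D (x * y)) ->
  (forall x, D x -> D x^-1) -> D 1 -> a != 0 -> (0 < i)%N -> coprime i l ->
  D (a ^+ i) -> D (a ^+ l) -> D a.
Proof.
move=> DM DV D1 a0 i0 co Di Dl.
have DX x n : D x -> D (x ^+ n).
  by move=> Dx; elim: n => [|n IH] //; rewrite exprS; apply: DM.
case: (egcdnP l i0) => u v e _; move: co; rewrite /coprime => /eqP co.
have -> : a = (a ^+ i) ^+ u / (a ^+ l) ^+ v.
  by rewrite -!exprM [(i * u)%N]mulnC [(l * v)%N]mulnC e co exprD expr1 [X in X / _]mulrC mulfK // expf_neq0.
by apply: DM; [exact: DX|apply/DV/DX].
Qed.

Lemma distinct_roots (K : closedFieldType) l (c : K) : l%:R != 0 :> K -> c != 0 ->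
  exists r : seq K, [/\ uniq r, size r = l & forall b, b \in r -> b ^+ l = c].
Proof.
move=> lK c0; have [w pw] := closed_prim_root lK; have l0 := prim_order_gt0 pw.
have [|b /rootP] := closed_rootP ('X^l - c%:P : {poly K}) _.
  by rewrite size_XnsubC // -lt0n.
rewrite hornerD hornerN hornerXn hornerC => /subr0_eq bl.
have b0 : b != 0 by move: c0; rewrite -bl expf_eq0 l0.
exists [seq b * w ^+ i | i <- iota 0 l]; split; rewrite ?size_map ?size_iota //.
  rewrite map_inj_in_uniq ?iota_uniq // => i j; rewrite !mem_iota /= => il jl /(mulfI b0) /eqP.
  by rewrite (eq_prim_root_expr pw) !modn_small // => /eqP.
move=> _ /mapP[i _ ->].
by rewrite exprMn bl -exprM mulnC exprM (prim_expr_order pw) expr1n mulr1.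
Qed.

Section Existence.
Variables (F : closedFieldType) (O : closedFieldType) (x : F -> O).
Hypothesis O0 : has_char O 0.
Hypothesis freex : forall a, ~ acl [set x b | b in [set b | b <> a]] (x a).

Implicit Types G : set (F * O).

Let domu G : set F := [set a | exists b, G (a, b)].
Let ranu G : set O := [set b | exists a, G (a, b)].
Let Cof G : set F := [set a | G (a, x a)].

(** The bound on the domain provides a basis modulo torsion with independent images
    at the end; the bound on the range leaves x a transcendental as long as a is not
    in the domain.  *)
Let good G := [/\ unit_iso G, domu G `<=` mclosure (Cof G) & ranu G `<=` acl (x @` domu G)].

Let good1 : good [set p | p = (1, 1)].
Proof.
split.
- split=> // [_ _ _ _ [-> ->] [-> ->]|_ _ [-> ->]|_ _ [-> ->]|_ _ [-> ->]] //=.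
  + by rewrite !mulr1.
  + by rewrite !invr1.
  + by rewrite !oner_neq0.
- move=> _ [_ [-> _]]; exact: mclosure1.
- by move=> _ [_ [_ ->]]; case: (acl_subfield (x @` domu [set p | p = (1, 1)])).
Qed.

Let good_mono G H a b : G `<=` H -> good G -> G (a, b) -> mclosure (Cof H) a /\ acl (x @` domu H) b.
Proof.
move=> GH [_ dG rG] Gab; split.
  apply: (mclosure_mono _ (dG a _)); last by exists b.
  by move=> c /GH.
apply: (acl_mono _ (rG b _)); last by exists a.
by move=> _ [c [c' Gc] <-]; exists c => //; exists c'; apply: GH.
Qed.

Let good_chain (S : set (set (F * O))) : S `<=` good -> S !=set0 ->
  total_on S subset -> good (\bigcup_(X in S) X).
Proof.
move=> Sg [X0 SX0] tot; set U := \bigcup_(X in S) X.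
have sU X : S X -> X `<=` U by move=> SX; apply: bigcup_sup.
have two p q : U p -> U q -> exists X, [/\ S X, X p & X q].
  move=> [X SX Xp] [Y SY Yq]; case: (tot _ _ SX SY) => h.
    by exists Y; split=> //; apply: h.
  by exists X; split=> //; apply: h.
split; first split.
- by apply: (sU _ SX0); case: (Sg _ SX0) => [[]].
- move=> a a' b b' /two h /h[X [SX Xa Xb]]; apply: (sU _ SX).
  by case: (Sg _ SX) => [[_ + _ _ _] _ _]; apply.
- move=> a a' [X SX Xa]; apply: (sU _ SX).
  by case: (Sg _ SX) => [[_ _ + _ _] _ _]; apply.
- by move=> a a' [X SX Xa]; case: (Sg _ SX) => [[_ _ _ + _] _ _]; apply.
- by move=> a a' [X SX Xa]; case: (Sg _ SX) => [[_ _ _ _ +] _ _]; apply.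
- by move=> a [b [X SX Xab]]; case: (good_mono (sU _ SX) (Sg _ SX) Xab).
- by move=> b [a [X SX Xab]]; case: (good_mono (sU _ SX) (Sg _ SX) Xab).
Qed.

Let extend G a b : good G -> (forall H, good H -> G `<=` H -> H `<=` G) ->
  a != 0 -> b != 0 -> matching G a b -> mclosure (Cof G) a \/ b = x a ->
  acl (x @` domu G) b \/ b = x a -> domu G a.
Proof.
move=> gG maxG a0 b0 hab ha hb; case: (gG) => hG dG rG.
pose H := adjoin_unit G a b; have GH : G `<=` H by exact: sub_adjoin_unit.
have G1 : G (1, 1) by case: hG.
have Hab : H (a, b) by exact: adjoin_unit_gen.
suff gH : good H by exists b; apply: (maxG H).
have mclosureA : mclosure (Cof H) a.
  case: ha => [|e]; last by apply: sub_mclosure; rewrite // /Cof /= -e.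
  by apply: mclosure_mono => c /GH.
have aclB : acl (x @` domu H) b.
  case: hb => [|e]; last by apply: sub_acl; exists a => //; exists b.
  by apply: acl_mono => _ [c [c' /GH Hc] <-]; exists c => //; exists c'.
split; first exact: adjoin_unit_iso.
  move=> _ [_ [h [h' [i [j [Gh [-> _]]]]]]].
  have [hh _] := good_mono GH gG Gh.
  by apply: mclosureM; [apply: mclosureM => //; exact: mclosureX|apply/mclosureV/mclosureX].
move=> _ [_ [h [h' [i [j [Gh [_ ->]]]]]]].
have [_ hh] := good_mono GH gG Gh.
have sS := acl_subfield (x @` domu H); have sR := subfieldW sS.
case: (sS) => _ _; apply; last exact: (subringX _ sR).
by apply: (subringM sR) => //; exact: (subringX _ sR).
Qed.

(** Assume that a is missing in the domain of a maximal G.  If no power of a is in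
    the domain, (a, x a) can be added.  Otherwise, some power a1 of a is missing
    whose l-th power is present, for a prime l.  Its image c has l distinct l-th
    roots.  They cannot all be in the range: their preimages together with a1 would
    be l + 1 roots of X^l - a1^l.  A root b out of the range can be matched with
    a1, since i is a multiple of l whenever a1^i is in the domain or b^i is in the
    range.  *)
Let surj G : good G -> (forall H, good H -> G `<=` H -> H `<=` G) ->
  forall a, a != 0 -> domu G a.
Proof.
move=> gG maxG a a0; case: (gG) => hG dG rG; case: (hG) => G1 GM GV Gn Gi.
have domM u v : domu G u -> domu G v -> domu G (u * v).
  by move=> [u' Gu] [v' Gv]; exists (u' * v'); apply: GM.
have domV u : domu G u -> domu G u^-1 by move=> [u' Gu]; exists u'^-1; apply: GV.
have dom1 : domu G 1 by exists 1.
have ranM u v : ranu G u -> ranu G v -> ranu G (u * v).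
  by move=> [u' Gu] [v' Gv]; exists (u' * v'); apply: GM.
have ranV u : ranu G u -> ranu G u^-1 by move=> [u' Gu]; exists u'^-1; apply: GV.
have ran1 : ranu G 1 by exists 1.
apply: contrapT => na.
have [[n0 n00 hn0]|notor] := pselect (exists2 n, (0 < n)%N & domu G (a ^+ n)); last first.
  apply: (na); apply: (extend gG maxG a0 (b := x a)) => //; [|move=> h h' i Gh|by right|by right].
    by apply/eqP => e; apply: (freex (a := a)); rewrite e; exact: acl0.
  have [h0 h'0] := Gn _ _ Gh.
  have [->|i0] := posnP i; first by rewrite !expr0 !mulr1; exact: Gi.
  split=> e; exfalso.
    apply: notor; exists i => //; have -> : a ^+ i = h^-1 by rewrite -[LHS](mulKf h0) e mulr1.
    by apply: domV; exists h'.
  have na' : ~ acl (x @` domu G) (x a).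
    move=> hx; apply: (freex (a := a)); apply: acl_mono hx => _ [c Gc <-]; exists c => //=.
    by move=> ca; apply: na; rewrite -ca.
  apply: na'; apply: (acl_root_exp i0).
  have -> : x a ^+ i = h'^-1 by rewrite -[LHS](mulKf h'0) e mulr1.
  by apply: (subfieldV (acl_subfield _)); apply: rG; exists h.
have exn : exists n, (0 < n)%N && `[< domu G (a ^+ n) >].
  by exists n0; rewrite n00; apply/asboolP.
have [n /andP[n1 /asboolP an] minn] := ex_minnP exn.
have n_gt1 : (1 < n)%N.
  by rewrite ltn_neqAle n1 andbT; apply/negP => /eqP en; apply: na; move: an; rewrite -en expr1.
pose l := pdiv n; have pl : prime l by exact: pdiv_prime.
have l0 := prime_gt0 pl.
pose a1 := a ^+ (n %/ l).
have a10 : a1 != 0 by rewrite expf_neq0.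
have na1 : ~ domu G a1.
  move=> h; have := minn (n %/ l)%N; rewrite divn_gt0 // dvdn_leq ?pdiv_dvd //=.
  move=> /(_ (introT (asboolP _) h)); rewrite leqNgt ltn_Pdiv // prime_gt1 //.
have [c Gc] : domu G (a1 ^+ l) by rewrite -exprM divnK ?pdiv_dvd.
have [_ c0] := Gn _ _ Gc.
have lO : l%:R != 0 :> O.
  by apply/negP => /eqP/eqP e; have := char0_intr_eq0 l O0; rewrite -pmulrn e; case: (l) l0.
have [r [ur sr rr]] := distinct_roots lO c0.
have [b br nb] : exists2 b, b \in r & ~ ranu G b.
  apply: contrapT => nex.
  have hr b : b \in r -> ranu G b by move=> br; apply: contrapT => nb; apply: nex; exists b.
  have /choice[f hf] b : exists h, b \in r -> G (h, b).
    by have [/hr[h Gh]|nbr] := boolP (b \in r); [exists h|exists 0].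
  (* One root too many for X^l - a1^l. *)
  pose s := a1 :: map f r.
  have us : uniq s.
    rewrite /= map_inj_in_uniq ?ur ?andbT.
      by apply/negP => /mapP[b br eb]; apply: na1; rewrite eb; exists b; apply: hf.
    by move=> b b' br br' /(unit_iso_inj hG (hf _ br) (hf _ br')).
  have rs : all (root ('X^l - (a1 ^+ l)%:P)) s.
    apply/allP => y; rewrite inE rootE hornerD hornerN hornerXn hornerC subr_eq0.
    case/orP=> [/eqP->//|/mapP[b br ->]]; apply/eqP.
    by apply/(unit_iso_inj hG (unit_isoX l hG (hf _ br)) Gc)/rr.
  have p0 : 'X^l - (a1 ^+ l)%:P != 0 by rewrite -size_poly_gt0 size_XnsubC.
  have := max_poly_roots p0 rs us.
  by rewrite size_XnsubC //= size_map sr ltnn.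
have bl := rr _ br.
have b0 : b != 0 by move: c0; rewrite -bl expf_eq0 l0.
apply: (na1); apply: (extend gG maxG a10 b0).
- move=> h h' i Gh; have [h0 h'0] := Gn _ _ Gh.
  have [li|li] := boolP (l %| i)%N.
    apply: Gi; apply: GM => //; rewrite -(divnK li) mulnC !exprM bl; exact: unit_isoX.
  have i0 : (0 < i)%N by rewrite lt0n; apply: contraNneq li => ->; rewrite dvdn0.
  have co : coprime i l by rewrite coprime_sym prime_coprime.
  split=> e; exfalso.
    apply: (na1); apply: (coprime_exp_mem domM domV dom1 a10 i0 co); last by exists c.
    have -> : a1 ^+ i = h^-1 by rewrite -[LHS](mulKf h0) e mulr1.
    by apply: domV; exists h'.
  apply: nb; apply: (coprime_exp_mem ranM ranV ran1 b0 i0 co); last by rewrite bl; exists (a1 ^+ l).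
  have -> : b ^+ i = h'^-1 by rewrite -[LHS](mulKf h'0) e mulr1.
  by apply: ranV; exists h.
- by left; apply: (mclosure_root l0); apply: dG; exists c.
- by left; apply: (acl_root_exp l0); rewrite bl; apply: rG; exists (a1 ^+ l).
Qed.

(** Every unit of F is dependent on the elements c with chi c = x c, whose values are
    independent, so [generic_of_basis] applies.  *)
Lemma exists_generic : exists chi : F -> O,
  [/\ is_character chi, generic chi & forall a, acl (range x) (chi a)].
Proof.
have [G [gG maxG]] := Zorn_chain good1 good_chain.
have sG := surj gG maxG; case: (gG) => hG dG rG; case: (hG) => G1 GM GV Gn Gi.
have /choice[chi hchi] a : exists b, (a != 0 -> G (a, b)) /\ (a = 0 -> b = 0).
  have [->|a0] := eqVneq a 0; first by exists 0.
  by have [b Gab] := sG a a0; exists b; split=> // e; rewrite e eqxx in a0.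
have Gchi a : a != 0 -> G (a, chi a) by case: (hchi a).
have chi_0 : chi 0 = 0 by case: (hchi 0) => _; apply.
have fG a b : a != 0 -> G (a, b) -> chi a = b.
  by move=> a0 Gab; apply/(unit_iso_inj hG (Gchi a a0) Gab).
have char_chi : is_character chi.
  split=> [a b||] //; last by apply: fG => //; exact: oner_neq0.
  have [->|a0] := eqVneq a 0; first by rewrite mul0r chi_0 mul0r.
  have [->|b0] := eqVneq b 0; first by rewrite mulr0 chi_0 mulr0.
  by apply: fG; [rewrite mulf_neq0|apply: GM; exact: Gchi].
have inj_chi : injective chi.
  move=> a b; have [->|a0] := eqVneq a 0.
    have [->//|b0] := eqVneq b 0; rewrite chi_0 => e.
    by have [_] := Gn _ _ (Gchi b b0); rewrite -e eqxx.
  have [->|b0] := eqVneq b 0.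
    by rewrite chi_0 => e; have [_] := Gn _ _ (Gchi a a0); rewrite e eqxx.
  by move=> e; apply/(unit_iso_inj hG (Gchi a a0) (Gchi b b0)).
exists chi; split=> //.
  apply: (generic_of_basis char_chi (C := Cof G)) => //.
    move=> n c injc Gc i; have cx j : chi (c j) = x (c j).
      by apply: fG (Gc j); have [] := Gn _ _ (Gc j).
    rewrite cx => h; apply: (freex (a := c i)); apply: acl_mono h => _ [j /= ji <-].
    by exists (c j); [move=> /injc /eqP; rewrite (negbTE ji)|rewrite /= cx].
  by move=> a a0; apply: dG; exact: sG.
move=> a; have [->|a0] := eqVneq a 0; first by rewrite chi_0; exact: acl0.
apply: (acl_mono _ (rG (chi a) _)); last by exists a; exact: Gchi.
by move=> _ [c _ <-]; exists c.
Qed.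

End Existence.

(** * Transcendence degrees *)

Lemma has_char_morph (K L : fieldType) (f : {rmorphism K -> L}) p : has_char K p <-> has_char L p.
Proof.
case: p => [|p] /=; last by rewrite (fmorph_pchar f).
by split=> h q; have := h q; rewrite (fmorph_pchar f).
Qed.

Lemma base_field p : p = 0%N \/ prime p -> exists k : closedFieldType, has_char k p.
Proof.
case=> [->|pp]; first by exists algC; exact: algC_char0.
have [k [f _]] := countable_algebraic_closure 'F_p.
exists k; apply/(has_char_morph f).
by case: p pp f => // p pp f; exact: pchar_Fp.
Qed.

Lemma free_field p (I : Type) : p = 0%N \/ prime p ->
  exists (O : closedFieldType) (x : I -> O), has_char O p /\
    forall i, ~ acl [set x j | j in [set j | j <> i]] (x i).
Proof.
move=> /base_field[k kp]; have [O [c [x hx]]] := big_field k I.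
by exists O, x; split=> //; apply/(has_char_morph c).
Qed.

(** [acl_fin] reduces a dependence inside B to a dependence between finitely many
    distinct elements, to which [alg_independentP] applies.  *)
Lemma transcendence_basisP (L : fieldType) (A B : set L) :
  transcendence_basis (gen A) B <->
  (forall b, B b -> ~ acl (A `|` (B `\ b)) b) /\ (forall x, acl (A `|` B) x).
Proof.
have spanE x : algebraic_over (gen (gen A `|` B)) x <-> acl (A `|` B) x.
  by rewrite -acl_genU.
split=> [[ind span]|[ind span]]; (split; last by move=> x; apply/spanE).
  move=> b Bb /acl_fin[s [Bs]].
  (* The tuple has b in front and the parameters of the dependence behind it. *)
  pose t := b :: undup s.
  have ut : uniq t.
    by rewrite /= undup_uniq andbT mem_undup; apply/negP => /Bs[_]; apply.
  pose a (i : 'I_(size t)) := t`_i.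
  have inja : injective a by move=> i j /eqP; rewrite nth_uniq // => /eqP/val_inj.
  have aB i : B (a i).
    have : a i \in t by apply: mem_nth.
    by rewrite inE mem_undup => /orP[/eqP->|/Bs[]].
  have /(alg_independentP _ (gen_subfield A)) := ind _ a inja aB.
  move=> /(_ ord0) h1 h2; apply: h1; rewrite acl_genU.
  apply: acl_mono h2 => y [|/= ys]; [by left|right].
  have yt : (index y t < size t)%N by rewrite index_mem inE mem_undup ys orbT.
  exists (Ordinal yt); last by rewrite /a /= nth_index // inE mem_undup ys orbT.
  by rewrite /= -val_eqE /=; case: (eqVneq b y) => // e; case: (Bs y ys) => _; case.
move=> n a inja aB; apply/(alg_independentP _ (gen_subfield A)) => j; rewrite acl_genU => h.
apply: (ind (a j) (aB j)); apply: acl_mono h => y [|[l /= lj <-]]; [by left|right].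
by split=> // /inja /eqP; rewrite (negbTE lj).
Qed.

(** The y j form a transcendence basis of the relative closure of A and the y j over
    A; the statement is transported along the embedding of that closure.  *)
Lemma trdeg_closure (L : closedFieldType) (A : set L) (I : Type) (y : I -> L) :
  (forall i, ~ acl (A `|` [set y j | j in [set j | j <> i]]) (y i)) ->
  exists (C : closedFieldType) (i : {rmorphism C -> L}),
    (forall z, (A `|` range y) z -> exists c, i c = z) /\
    trdeg_eq (gen (i @^-1` A)) I.
Proof.
move=> indy; have [C [i hi]] := relative_closure (A `|` range y).
have lift z : (A `|` range y) z -> exists c, i c = z by move=> /sub_acl/hi.
exists C, i; split=> //.
have /choice[g hg] j : exists c, i c = y j by apply: lift; right; exists j.
have injy : injective y.
  move=> j l e; apply: contrapT => jl; apply: (indy j); apply: sub_acl; right.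
  by exists l => //= lj; apply: jl.
have injg : injective g by move=> j l e; apply: injy; rewrite -!hg e.
exists (range g); split; last by apply: inj_card_eq => j l _ _; exact: injg.
have iA : i @` (i @^-1` A) = A.
  rewrite eqEsubset; split; first by move=> _ [c Ac <-].
  by move=> z Az; have [c ec] := lift z (or_introl Az); exists c; rewrite //= ec.
apply/transcendence_basisP; split=> [_ [j _ <-]|c].
  move=> /(acl_morph i); rewrite image_setU iA hg => h; apply: (indy j).
  apply: acl_mono h => z [|[c [[l _ <-] /= lj] <-]]; [by left|right].
  by exists l => //= e; apply: lj; rewrite e.
apply/(acl_morph i); rewrite image_setU iA.
have -> : i @` range g = range y.
  by rewrite image_comp; congr image; apply/funext => j /=.
by apply/hi; exists c.
Qed.

Lemma steinitz_trdeg (L L' : closedFieldType) (G : set (L * L')) (A : set L) (A' : set L')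
    (I : Type) : subring_rel G -> gen (dom_rel G) = gen A -> gen (ran_rel G) = gen A' ->
  trdeg_eq (gen A) I -> trdeg_eq (gen A') I ->
  exists g : {rmorphism L -> L'}, bijective g /\ forall u u', G (u, u') -> g u = u'.
Proof.
move=> hG eA eA' [B [/transcendence_basisP[iB sB] cB]] [B' [/transcendence_basisP[iB' sB'] cB']].
have cBB' : (B #= B')%card by apply: card_eq_trans cB _; rewrite card_eq_sym.
pose P : pointedType := HB.pack (GRing.ClosedField.sort L') (isPointed.Build L' 0).
have /card_set_bijP[f [fB finj fsurj]] : ((B : set L) #= (B' : set P))%card by [].
have aclA S : acl (dom_rel G `|` S) = acl (A `|` S) by rewrite -acl_genU eA acl_genU.
have aclA' S : acl (ran_rel G `|` S) = acl (A' `|` S) by rewrite -acl_genU eA' acl_genU.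
apply: (@steinitz L L' G B B' f hG).
- by move=> b; apply: fB.
- by move=> b c Bb Bc; apply: finj; rewrite inE.
- by move=> b' /fsurj[b Bb <-]; exists b.
- by move=> b Bb; rewrite aclA; apply: iB.
- by move=> b Bb; rewrite aclA'; apply: iB'.
- by move=> z; rewrite aclA.
- by move=> z; rewrite aclA'.
Qed.

(** * Existence and uniqueness of models *)

Lemma intr_eq0_char (L L' : fieldType) p (m : int) : p = 0%N \/ prime p ->
  has_char L p -> has_char L' p -> m%:~R = 0 :> L -> m%:~R = 0 :> L'.
Proof.
move=> [->|pp] hL hL' /eqP.
  by rewrite char0_intr_eq0 // => /eqP ->.
have [hp hp'] : p \in [pchar L] /\ p \in [pchar L'] by move: hL hL'; case: (p) pp.
have n0 n : (n%:R == 0 :> L) = (n%:R == 0 :> L') by rewrite -!(dvdn_pcharf hp) -(dvdn_pcharf hp').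
case: m => n; rewrite ?NegzE ?mulrNz ?oppr_eq0 -!pmulrn n0 => /eqP // ->.
by rewrite oppr0.
Qed.

Lemma prime_field_isomorphism (L L' : closedFieldType) p (I : Type) : p = 0%N \/ prime p ->
  has_char L p -> has_char L' p ->
  trdeg_eq (prime_subfield L) I -> trdeg_eq (prime_subfield L') I ->
  exists f : {rmorphism L -> L'}, bijective f.
Proof.
move=> hp cL cL'; pose G : set (L * L') := [set q | exists m : int, q = (m%:~R, m%:~R)].
have hG : subring_rel G.
  split.
  - by exists 1.
  - by move=> _ _ _ _ [m [-> ->]] [n [-> ->]]; exists (m - n); rewrite !rmorphB.
  - by move=> _ _ _ _ [m [-> ->]] [n [-> ->]]; exists (m * n); rewrite !rmorphM.
  - by move=> _ _ [m [-> ->]]; split; exact: (intr_eq0_char hp).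
have eL : gen (dom_rel G) = gen set0.
  rewrite eqEsubset; split; last exact: gen_mono.
  apply: gen_min; first exact: gen_subfield.
  by move=> _ [_ [m [-> _]]]; exact: (subring_intr m (subfieldW (gen_subfield _))).
have eL' : gen (ran_rel G) = gen set0.
  rewrite eqEsubset; split; last exact: gen_mono.
  apply: gen_min; first exact: gen_subfield.
  by move=> _ [_ [m [_ ->]]]; exact: (subring_intr m (subfieldW (gen_subfield _))).
move=> tL tL'; have [f [bf _]] := steinitz_trdeg hG eL eL' tL tL'.
by exists f.
Qed.

Section CharacterIsomorphism.
Variables (F K K' : closedFieldType) (chi : F -> K) (chi' : F -> K').
Hypotheses (hchi : is_character chi) (hchi' : is_character chi').
Hypotheses (gchi : generic chi) (gchi' : generic chi').
Hypotheses (K0 : has_char K 0) (K'0 : has_char K' 0).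

(** Z-linear combinations suffice to form a ring, since the values of a character are
    closed under products.  *)
Definition character_graph : set (K * K') :=
  [set q | exists (J : finType) (c : J -> int) (a : J -> F),
     q = (\sum_j (c j)%:~R * chi (a j), \sum_j (c j)%:~R * chi' (a j))].

Lemma character_graph_gen a : character_graph (chi a, chi' a).
Proof. by exists unit, (fun=> 1), (fun=> a); rewrite !(big_pred1 tt) ?mul1r //; case. Qed.

Lemma character_graph_rel : subring_rel character_graph.
Proof.
split.
- by rewrite -(chi1 hchi) -(chi1 hchi'); exact: character_graph_gen.
- move=> _ _ _ _ [J [c [a [-> ->]]]] [J' [c' [a' [-> ->]]]].
  exists (J + J')%type, (fun j => match j with inl j => c j | inr j => - c' j end),
    (fun j => match j with inl j => a j | inr j => a' j end).
  rewrite !big_sumType /=; congr (_ + _, _ + _).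
    by rewrite -sumrN; apply: eq_bigr => j _; rewrite rmorphN mulNr.
  by rewrite -sumrN; apply: eq_bigr => j _; rewrite rmorphN mulNr.
- move=> _ _ _ _ [J [c [a [-> ->]]]] [J' [c' [a' [-> ->]]]].
  exists (J * J')%type, (fun j => c j.1 * c' j.2), (fun j => a j.1 * a' j.2).
  rewrite !big_distrlr /= !pair_big /=; congr (_, _); apply: eq_bigr => j _.
    by rewrite rmorphM (chiM hchi) mulrACA.
  by rewrite rmorphM (chiM hchi') mulrACA.
- move=> _ _ [J [c [a [-> ->]]]].
  by split; [apply: character_relation hchi hchi' K0 K'0 _ a c gchi gchi'
            |apply: character_relation hchi' hchi K'0 K0 _ a c gchi' gchi].
Qed.

Lemma character_isomorphism (I : Type) :
  trdeg_eq (gen (range chi)) I -> trdeg_eq (gen (range chi')) I ->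
  exists g : {rmorphism K -> K'}, bijective g /\ forall a, g (chi a) = chi' a.
Proof.
move=> tK tK'.
have e1 : gen (dom_rel character_graph) = gen (range chi).
  rewrite eqEsubset; split; apply: gen_min (gen_subfield _) _.
    have sS := subfieldW (gen_subfield (range chi)).
    move=> _ [_ [J [c [a [-> _]]]]]; apply: (subring_sum _ sS) => j _.
    apply: (subringM sS); first exact: (subring_intr _ sS).
    by apply: sub_gen; exists (a j).
  by move=> _ [a _ <-]; apply: sub_gen; exists (chi' a); exact: character_graph_gen.
have e2 : gen (ran_rel character_graph) = gen (range chi').
  rewrite eqEsubset; split; apply: gen_min (gen_subfield _) _.
    have sS := subfieldW (gen_subfield (range chi')).
    move=> _ [_ [J [c [a [_ ->]]]]]; apply: (subring_sum _ sS) => j _.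
    apply: (subringM sS); first exact: (subring_intr _ sS).
    by apply: sub_gen; exists (a j).
  by move=> _ [a _ <-]; apply: sub_gen; exists (chi a); exact: character_graph_gen.
have [g [bg hg]] := steinitz_trdeg character_graph_rel e1 e2 tK tK'.
by exists g; split=> // a; apply/hg/character_graph_gen.
Qed.

End CharacterIsomorphism.

Lemma is_character_comp (F F' K : closedFieldType) (f : {rmorphism F -> F'}) (chi : F' -> K) :
  is_character chi -> is_character (chi \o f).
Proof.
by move=> [hM h0 h1]; split=> [a b||] /=; rewrite ?rmorphM ?rmorph0 ?rmorph1 ?hM ?h0 ?h1.
Qed.

Lemma generic_comp (F F' K : closedFieldType) (f : {rmorphism F -> F'}) (chi : F' -> K) :
  generic chi -> generic (chi \o f).
Proof.
move=> [inj_chi hg]; split; first exact: inj_comp inj_chi (fmorph_inj f).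
move=> n a n0 ha; apply: (hg n (f \o a) n0) => -[k [l [kl e]]]; apply: ha.
exists k, l; split=> //; apply: (fmorph_inj f); rewrite !rmorph_prod.
by under eq_bigr do rewrite rmorphXn; under [RHS]eq_bigr do rewrite rmorphXn.
Qed.

Lemma models_isomorphic p kappa lambda (M N : ACFC_model p) : p = 0%N \/ prime p ->
  has_trdegs M kappa lambda -> has_trdegs N kappa lambda -> L_isomorphic M N.
Proof.
move=> hp [tF tK] [tF' tK'].
have [f bf] := prime_field_isomorphism hp (dom_char M) (dom_char N) tF tF'.
have rf : range (@chi p N \o f) = range (@chi p N).
  rewrite eqEsubset; split; first by move=> _ [a _ <-]; exists (f a).
  by have [f' _ f'K] := bf; move=> _ [a _ <-]; exists (f' a); rewrite //= f'K.
have [|g [bg hg]] := character_isomorphism (chi_character M)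
    (is_character_comp f (chi_character N)) (chi_generic M)
    (generic_comp f (chi_generic N)) (cod_char0 M) (cod_char0 N) tK.
  by rewrite rf.
by exists f, g.
Qed.

(** The elements of O' are indexed by F and lambda together: the former are spent by
    the character, and the latter remain independent over its values because all
    of these are algebraic over the former.  *)
Lemma model_exists p kappa lambda : p = 0%N \/ prime p ->
  exists M : ACFC_model p, has_trdegs M kappa lambda.
Proof.
move=> hp; have [O [x [Op fx]]] := @free_field p kappa hp.
have [|F [i [_ tF]]] := @trdeg_closure O set0 kappa x.
  by move=> j; rewrite set0U; apply: fx.
rewrite preimage_set0 in tF.
have Fp : has_char F p by apply/(has_char_morph i).
have [O' [y [O'0 fy]]] := @free_field 0 (F + lambda)%type (or_introl erefl).
have [|chi0 [cchi0 gchi0 hchi0]] := @exists_generic F O' (y \o inl) O'0.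
  move=> a h; apply: (fy (inl a)); apply: acl_mono h => _ [b /= ba <-].
  by exists (inl b) => //= -[].
have [|K [j [liftK tK]]] := @trdeg_closure O' (range chi0) lambda (y \o inr).
  move=> l h; apply: (fy (inr l)); apply: acl_min h => z [[a _ <-]|[l' /= ll <-]].
    by apply: acl_mono (hchi0 a) => _ [b _ <-]; exists (inl b).
  by apply: sub_acl; exists (inr l') => //= -[].
have /choice[chiK hK] a : exists c, j c = chi0 a by apply: liftK; left; exists a.
have cK : is_character chiK.
  case: cchi0 => hM h0 h1; split=> [a b||]; apply: (fmorph_inj j).
  - by rewrite rmorphM !hK hM.
  - by rewrite rmorph0 hK.
  - by rewrite rmorph1 hK.
have gK : generic chiK.
  split=> [a b e|n a n0 ha]; first by case: gchi0 => + _; apply; rewrite -!hK e.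
  apply/alg_independent_tofrac => l /(acl_morph j); rewrite hK => h.
  apply: (generic_acl (i := l) gchi0 ha); apply: acl_mono h => _ [_ [m lm <-] <-].
  by exists m; rewrite //= hK.
have K0 : has_char K 0 by apply/(has_char_morph j).
exists (Build_ACFC_model cK gK K0 Fp); split=> //=.
suff <- : j @^-1` range chi0 = range chiK by [].
rewrite eqEsubset; split=> [c [a _ e]|_ [a _ <-]]; last by exists a; rewrite // -hK.
by exists a => //; apply: (fmorph_inj j); rewrite hK.
Qed.

Local Close Scope ring_scope.

Theorem theorem1p2 (p : nat) (kappa lambda : Type) (hp : p = 0 \/ prime p) :
  exists M : ACFC_model p,
    has_trdegs M kappa lambda /\
    forall N : ACFC_model p, has_trdegs N kappa lambda -> L_isomorphic M N.
Proof.
have [M hM] := model_exists kappa lambda hp.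
exists M; split=> // N hN; exact: models_isomorphic hp hM hN.
Qed.
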